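(* Let $p\ge1$, $r\in[1,\infty]$, and let $\mu$ be a probability measure on $\mathbb{R}^d$ with finite $p$-th moment. Let $\Sigma$ be a symmetric, positive definite $d\times d$ matrix. Then one can construct two random vectors $W\sim\mu$ and $Z\sim N(0,I_d)$ defined on a common probability space such that $$\bigl\|\,|W-\Sigma^{1/2}Z|_r\bigr\|_{L^p}\le2\int_0^\infty\|\rho_t(F_t)\|_{p,r}\,dt,$$ where $Z_2\sim N(0,I_d)$ is independent of $W$ and $$F_t=e^{-t}W+\sqrt{1-e^{-2t}}\,\Sigma^{1/2}Z_2,\qquad\rho_t(F_t)=e^{-t}\,\mathbb{E}\left[W-\frac{1}{\sqrt{e^{2t}-1}}\Sigma^{1/2}Z_2\,\Big|\,F_t\right].$$
   Context: $|x|_r$ is the $\ell^r$ norm on $\mathbb{R}^d$; for a random vector $X$, $\|X\|_{p,r}:=(\mathbb{E}|X|_r^p)^{1/p}$; $\|Y\|_{L^p}=(\mathbb{E}|Y|^p)^{1/p}$ for a scalar random variable $Y$. The right-hand side depends only on $\mu$ (the law of $W$) and $\Sigma$. *)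

(* Defs.v *)
From HB Require Import structures.
From mathcomp Require Import all_boot all_order all_algebra.
From mathcomp Require Import all_classical all_reals all_analysis.
Set Implicit Arguments.
Unset Strict Implicit.
Unset Printing Implicit Defensive.
Import Order.TTheory GRing.Theory Num.Theory.
Import numFieldNormedType.Exports.

Local Open Scope classical_set_scope.
Local Open Scope ring_scope.

(* R^d is 'cV[R]_d. Its Borel sigma-algebra is generated by the coordinate
   maps, as the library does for n.-tuple T. *)
Section measurable_colvector.
Context (R : realType) (d : nat).

Let coord : 'I_d -> 'cV[R]_d -> R := fun i x => x i 0.

Let cV_set0 : g_sigma_preimage coord set0.
Proof. exact: sigma_algebra0. Qed.

Let cV_setC A : g_sigma_preimage coord A -> g_sigma_preimage coord (~` A).
Proof. exact: sigma_algebraC. Qed.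

Let cV_bigcup (F : _^nat) : (forall i, g_sigma_preimage coord (F i)) ->
  g_sigma_preimage coord (\bigcup_i (F i)).
Proof. exact: sigma_algebra_bigcup. Qed.

HB.instance Definition _ := @isMeasurable.Build
  (measure_tuple_display default_measure_display)
  'cV[R]_d (g_sigma_preimage coord) cV_set0 cV_setC cV_bigcup.

End measurable_colvector.

(* The value at r = -oo is irrelevant: r ranges over [1, +oo]. *)
Definition lrnorm (R : realType) (d : nat) (r : \bar R) (x : 'cV[R]_d) : R :=
  match r with
  | r%:E => (\sum_(i < d) `|x i 0| `^ r) `^ r^-1
  | +oo%E => \big[Num.max/0]_(i < d) `|x i 0|
  | -oo%E => 0
  end.

Section linear_algebra.
Context (R : realType) (d : nat).
Implicit Types S T : 'M[R]_d.

Definition symmetric_mx S := S^T = S.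

Definition posdef_mx S :=
  forall x : 'cV[R]_d, x != 0 -> 0 < (x^T *m S *m x) 0 0.

Definition possemidef_mx S :=
  forall x : 'cV[R]_d, 0 <= (x^T *m S *m x) 0 0.

Definition is_sqrtmx S T :=
  [/\ symmetric_mx T, possemidef_mx T & T *m T = S].

(* For S symmetric positive semidefinite, is_sqrtmx S has exactly one element;
   the default value 0 is never used then. *)
Definition sqrtmx S : 'M[R]_d := xget 0 [set T | is_sqrtmx S T].

End linear_algebra.

Section random_vectors.
Context (R : realType) (d : nat).

(* Two measures on R^d are compared on measurable sets only, as the library's
   measures also take values on the other sets. *)
Definition has_law (dO : measure_display) (Omega : measurableType dO)
    (P : probability Omega R) (X : {RV P >-> 'cV[R]_d})
    (mu : probability 'cV[R]_d R) :=
  forall A, measurable A -> distribution P X A = mu A.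

(* N(0, I_d) is the d-fold product of N(0, 1), which is determined by its
   values on measurable boxes. *)
Definition is_std_gaussian (dO : measure_display) (Omega : measurableType dO)
    (P : probability Omega R) (X : {RV P >-> 'cV[R]_d}) :=
  forall A : 'I_d -> set R, (forall i, measurable (A i)) ->
    distribution P X [set x | forall i, A i (x i 0)] =
    (\prod_(i < d) normal_prob 0 1 (A i))%E.

Definition independent_RV (dO : measure_display) (Omega : measurableType dO)
    (P : probability Omega R) (X Y : {RV P >-> 'cV[R]_d}) :=
  forall A B, measurable A -> measurable B ->
    P (X @^-1` A `&` Y @^-1` B) = (P (X @^-1` A) * P (Y @^-1` B))%E.

Definition finite_moment (p : R) (mu : probability 'cV[R]_d R) :=
  (\int[mu]_x (lrnorm 2%:E x `^ p)%:E < +oo)%E.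

Definition LpNorm (dO : measure_display) (Omega : measurableType dO)
    (P : probability Omega R) (p : R) (r : \bar R) (X : Omega -> 'cV[R]_d) :=
  ('N[P]_(p%:E) [(fun w => (lrnorm r (X w))%:E)])%E.

End random_vectors.
Arguments has_law {R d dO Omega} P X mu.
Arguments is_std_gaussian {R d dO Omega} P X.
Arguments independent_RV {R d dO Omega} P X Y.

Section conditional_expectation.
Context (R : realType) (dO : measure_display) (Omega : measurableType dO).
Variable P : probability Omega R.

Definition is_cond_exp (G : set (set Omega)) (X Y : Omega -> R) :=
  [/\ forall B, measurable B -> G (Y @^-1` B),
      P.-integrable setT (EFin \o Y) &
      forall A, G A -> (\int[P]_(w in A) (Y w)%:E = \int[P]_(w in A) (X w)%:E)%E].

(* A chosen version of E[X | G]; one exists, and is unique up to P-negligible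
   sets, when X is integrable and G is a sub-sigma-algebra. *)
Definition cond_exp (G : set (set Omega)) (X : Omega -> R) : Omega -> R :=
  xget (cst 0) [set Y | is_cond_exp G X Y].

Definition sigma_of (d : nat) (F : Omega -> 'cV[R]_d) : set (set Omega) :=
  preimage_set_system setT F measurable.

Definition cond_exp_vec (d : nat) (X F : Omega -> 'cV[R]_d) (w : Omega) :
    'cV[R]_d :=
  \col_i cond_exp (sigma_of F) (fun w' => X w' i 0) w.

End conditional_expectation.

Section ornstein_uhlenbeck.
Context (R : realType) (d : nat) (dO : measure_display)
  (Omega : measurableType dO) (P : probability Omega R).
Variables (Sigma : 'M[R]_d) (W Z2 : Omega -> 'cV[R]_d).

Definition ou_interp (t : R) (w : Omega) : 'cV[R]_d :=
  expR (- t) *: W w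
  + Num.sqrt (1 - expR (- (2 * t))) *: (sqrtmx Sigma *m Z2 w).

(* rho_t(F_t) as a random vector on Omega. *)
Definition rho (t : R) (w : Omega) : 'cV[R]_d :=
  expR (- t) *:
    cond_exp_vec P
      (fun w' => W w'
         - (Num.sqrt (expR (2 * t) - 1))^-1 *: (sqrtmx Sigma *m Z2 w'))
      (ou_interp t) w.

End ornstein_uhlenbeck.

(* Main.v *)
(* Put F_t = e^-t W + sqrt(1 - e^-2t) G with G = Sigma^{1/2} Z_2, so that F_0 = W, F_oo = G and
   F_t' = - e^-t (W - G / sqrt(e^2t - 1)), whose conditional expectation given F_t is - rho_t(F_t).
   Take a fine time grid and a fine partition of R^d into cubes. Glue independent copies of the space
   of (W, Z_2) into a Markov chain: the k-th and (k+1)-st copies share the cube of F_{t_k} and are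
   conditionally independent given it. Along the chain, the displacement from W (first copy) to G
   (last copy) is the sum of
   - the means of the increments of F over the current cube, of L^p norm at most
     \int |rho_t(F_t)|_{p,r} dt up to a small error, since a cell mean is a further conditioning of
     rho_t and averaging over shifts of the grid turns the Riemann sum into the integral;
   - the increments centered on each cube: after truncation they are uniformly bounded and of total
     bounded variation, and they are martingale differences along the chain, so their sum is O(sqrt h)
     in L^2, hence small in L^p;
   - the truncation errors and the cube diameters.
   Hence the infimum w of the transport costs between mu and the law of Sigma^{1/2} Z is at most the
   right-hand side without its factor 2. If w > 0, some coupling has cost at most 2 w. If w = 0, the
   two laws agree on orthants, hence are equal, and W := Sigma^{1/2} Z works. *)
Require Import Defs.
From HB Require Import structures.
From mathcomp Require Import all_boot all_order all_algebra.
From mathcomp Require Import all_classical all_reals all_analysis.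
From mathcomp Require Import measurable_realfun ring lra.
Set Implicit Arguments.
Unset Strict Implicit.
Unset Printing Implicit Defensive.
Import Order.TTheory GRing.Theory Num.Theory.
Import numFieldNormedType.Exports.
Local Open Scope classical_set_scope.
Local Open Scope ring_scope.

(** * The l^r norm on column vectors *)

(** Sharing only a cube keeps every conditioning discrete: a glued measure is a countable sum of
    elementary conditional product measures, so no disintegration on R^d enters, at the price of one
    cube diameter per step. The cubes are therefore chosen after the number of steps; this is
    possible because the second-moment bound for the martingale part does not depend on them.
    Truncation is needed since W has only a p-th moment, with p possibly below 2, while
    orthogonality is an L^2 fact. The conditional expectation in rho_t is chosen separately for each
    t, so its norm need not be measurable in t. The averaging over shifts is applied to a measurable
    minorant instead, in which a cell mean replaces the conditional expectation. The coupling of the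
    conclusion must be found before W' and Z2 are given, so the chain serves only to bound an
    infimum that depends on mu and Sigma alone. The factor 2 is the price for not using the
    existence of an optimal coupling. *)

Lemma powR_tangent (R : realType) (p s u : R) : 1 <= p -> 0 <= s -> 0 <= u ->
  s `^ p + p * s `^ (p - 1) * (u - s) <= u `^ p.
Proof.
move=> p1 s0 u0.
have p0 : 0 < p by lra.
have [->|pn1] := eqVneq p 1.
  by rewrite subrr powRr0 !powRr1// !mul1r subrKC.
have q0 : 0 < p / (p - 1) by rewrite divr_gt0// subr_gt0 lt_neqAle eq_sym pn1.
have pn0 : p - 1 != 0 by rewrite subr_eq0.
have sE : s `^ p = s `^ (p - 1) * s.
  have [->|s_neq0] := eqVneq s 0; first by rewrite mulr0 powR0// gt_eqF.
  by rewrite -[X in _ * X](powRr1 s0) -powRD ?subrK// s_neq0 implybT.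
(* Young's inequality for [u * s ^ (p - 1)] with the conjugate exponent [p / (p - 1)], for which the
   second power is [s ^ p] again. The case [p = 1], where that exponent would be infinite, is
   settled above. *)
have := @conjugate_powR R u (s `^ (p - 1)) p (p / (p - 1)) u0 (powR_ge0 _ _) p0 q0.
rewrite -powRrM (mulrCA (p - 1)) mulfV// mulr1 => /(_ _)/=.
have -> : p^-1 + (p / (p - 1))^-1 = 1 by field; rewrite pn0 gt_eqF.
move=> /(_ erefl).
rewrite -(ler_pM2l p0) => H.
rewrite mulrBr -[p * _ * s]mulrA -sE.
apply: le_trans (_ : s `^ p - p * s `^ p + p * (u `^ p / p + s `^ p / (p / (p - 1))) <= _); first by nra.
have -> : p * (u `^ p / p + s `^ p / (p / (p - 1))) = u `^ p + (p - 1) * s `^ p.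
  by field; rewrite pn0 gt_eqF.
by nra.
Qed.

Section lrnorm_theory.
Context (R : realType) (d : nat) (r : \bar R).
Hypothesis r1 : (1 <= r)%E.
Implicit Types (x y v : 'cV[R]_d) (a : R).
Local Notation N := (lrnorm r).

Lemma lrnorm_ge0 x : 0 <= N x.
Proof.
rewrite /lrnorm; case: r => [s| |]//; first exact: powR_ge0.
by apply: bigmax_ge_id.
Qed.

Lemma lrnormZ a x : N (a *: x) = `|a| * N x.
Proof.
move: r1; rewrite /lrnorm; case: r => [s| |]//.
- rewrite lee_fin => s1.
  have s0 : s != 0 by rewrite gt_eqF//; lra.
  under eq_bigr => i _ do rewrite mxE normrM powRM//.
  rewrite -mulr_sumr powRM ?powR_ge0//; last by apply: sumr_ge0 => i _; exact: powR_ge0.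
  by rewrite -powRrM mulfV// powRr1.
- move=> _; under eq_bigr => i _ do rewrite mxE normrM.
  elim/big_rec2 : _ => [|i y1 y2 _ ->]; first by rewrite mulr0.
  by rewrite maxr_pMr.
Qed.

Lemma lrnorm0 : N (0 : 'cV[R]_d) = 0.
Proof. by rewrite -(scale0r (0 : 'cV[R]_d)) lrnormZ normr0 mul0r. Qed.

Lemma lrnormN x : N (- x) = N x.
Proof. by rewrite -scaleN1r lrnormZ normrN1 mul1r. Qed.

Lemma le_coord_lrnorm x i : `|x i 0| <= N x.
Proof.
move: r1; rewrite /lrnorm; case: r => [s| |]//.
- rewrite lee_fin => s1.
  have s0 : 0 < s by lra.
  rewrite -[leLHS](powRr1 (normr_ge0 _)) -(@mulfV _ s) ?gt_eqF// powRrM.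
  apply: ge0_ler_powR => //; rewrite ?nnegrE ?powR_ge0 ?invr_ge0 ?(ltW s0)//.
    by apply: sumr_ge0 => j _; exact: powR_ge0.
  rewrite (bigD1 i)//= lerDl; apply: sumr_ge0 => j _; exact: powR_ge0.
- by move=> _; exact: (@le_bigmax _ _ _ 0 (fun i => `|x i 0|) i).
Qed.

Lemma lrnorm_eq0 x : N x = 0 -> x = 0.
Proof.
move=> x0; apply/matrixP => i j; rewrite ord1 mxE; apply/eqP.
by rewrite -normr_le0 -x0; exact: le_coord_lrnorm.
Qed.

(** A norming functional treats all [r] uniformly: the triangle inequality and the convexity of
    powers of the norm both follow from it by linearity. *)
Lemma lrnorm_support v : exists l : 'I_d -> R,
  \sum_i l i * v i 0 = N v /\ forall x, \sum_i l i * x i 0 <= N x.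
Proof.
have [v0|vneq0] := eqVneq v 0.
  exists (fun=> 0); rewrite v0 lrnorm0; split.
    by rewrite big1// => i _; rewrite mul0r.
  by move=> x; rewrite big1 ?lrnorm_ge0// => i _; rewrite mul0r.
have Nv0 : 0 < N v.
  rewrite lt_neqAle lrnorm_ge0 andbT eq_sym; apply: contra vneq0 => /eqP.
  by move=> /lrnorm_eq0 ->.
have normalize x : x != 0 -> exists2 u, x = N x *: u & N u = 1.
  move=> xn0; have Nx0 : N x != 0 by apply: contra xn0 => /eqP/lrnorm_eq0 ->.
  exists ((N x)^-1 *: x); first by rewrite scalerA mulfV// scale1r.
  by rewrite lrnormZ ger0_norm ?invr_ge0 ?lrnorm_ge0// mulVf.
have [u vE u1] := normalize v vneq0.
(* By homogeneity it is enough to compare unit vectors. *)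
suff [l [lu lx]] : exists l : 'I_d -> R,
    \sum_i l i * u i 0 = 1 /\ forall x, N x = 1 -> \sum_i l i * x i 0 <= 1.
  exists l; split => [|x].
    rewrite [in LHS]vE; under eq_bigr do rewrite mxE mulrCA.
    by rewrite -mulr_sumr lu mulr1.
  have [->|xn0] := eqVneq x 0.
    by rewrite lrnorm0 big1// => i _; rewrite mxE mulr0.
  have [w xE w1] := normalize x xn0.
  rewrite [in leLHS]xE; under eq_bigr do rewrite mxE mulrCA.
  by rewrite -mulr_sumr ler_piMr ?lrnorm_ge0// lx.
move: r1 u1; rewrite /lrnorm; case: r => [s| |]//.
- rewrite lee_fin => s1.
  have s0 : 0 < s by lra.
  have sum1 (x : 'cV[R]_d) : (\sum_(i < d) `|x i 0| `^ s) `^ s^-1 = 1 ->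
      \sum_(i < d) `|x i 0| `^ s = 1.
    move=> /(congr1 (fun z => z `^ s)); rewrite -powRrM mulVf ?gt_eqF// powR1.
    by rewrite powRr1//; apply: sumr_ge0 => i _; exact: powR_ge0.
  move=> /sum1 u1.
  have uE i : `|u i 0| `^ (s - 1) * `|u i 0| = `|u i 0| `^ s.
    have [->|u_neq0] := eqVneq (u i 0) 0; first by rewrite normr0 mulr0 powR0// gt_eqF.
    by rewrite -[X in _ * X](powRr1 (normr_ge0 _)) -powRD ?subrK// normr_eq0 u_neq0 implybT.
  (* This is the gradient of the norm at the unit vector [u]. *)
  exists (fun i => Num.sg (u i 0) * `|u i 0| `^ (s - 1)); split.
    rewrite -[RHS]u1; apply: eq_bigr => i _; rewrite -uE.
    by rewrite [X in _ = _ * X]normrEsg; ring.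
  move=> x /sum1 x1.
  apply: (@le_trans _ _ (\sum_i `|u i 0| `^ (s - 1) * `|x i 0|)).
    apply: ler_sum => i _; rewrite mulrAC mulrC ler_wpM2l ?powR_ge0//.
    apply: (le_trans (ler_norm _)); rewrite normrM ler_piMl// normr_sg.
    by case: (u i 0 != 0).
  (* Tangent inequalities at the coordinates of [u], summed: both vectors have [s]-th power sum 1,
     so the linear term is at most 0, which is Hoelder's inequality here. *)
  have : \sum_i (`|u i 0| `^ s + s * `|u i 0| `^ (s - 1) * (`|x i 0| - `|u i 0|)) <= 1.
    rewrite -[X in _ <= X]x1; apply: ler_sum => i _.
    exact: (powR_tangent s1 (normr_ge0 _) (normr_ge0 _)).
  rewrite big_split/= u1 gerDl.
  under eq_bigr => i _ do rewrite -mulrA mulrBr uE.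
  by rewrite -mulr_sumr pmulr_rle0// sumrB u1 subr_le0.
- move=> _ u1.
  have [i0] : exists i : 'I_d, True.
    case: d v vneq0 {vE Nv0 normalize u u1} => [|n]; last by exists ord0.
    by move=> v /eqP[]; apply/matrixP => -[].
  move=> _.
  have [j _ jE] := @eq_bigmax _ _ _ 0 i0 xpredT (fun i => `|u i 0|) erefl (fun i _ => normr_ge0 _).
  (* The signed coordinate at which [u] attains its maximum. *)
  exists (fun i => if i == j then Num.sg (u j 0) else 0); split.
    rewrite (bigD1 j)//= eqxx big1 ?addr0; last first.
      by move=> i /negbTE ->; rewrite mul0r.
    by rewrite -[RHS]u1 jE [RHS]normrEsg.
  move=> x x1.
  rewrite (bigD1 j)//= eqxx big1 ?addr0; last first.
    by move=> i /negbTE ->; rewrite mul0r.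
  rewrite -x1; apply: le_trans (@le_bigmax _ _ _ 0 (fun i => `|x i 0|) j).
  apply: (le_trans (ler_norm _)); rewrite normrM ler_piMl// normr_sg.
  by case: (_ != 0).
Qed.

Lemma lrnormD x y : N (x + y) <= N x + N y.
Proof.
have [l [<- lx]] := lrnorm_support (x + y).
under eq_bigr do rewrite mxE mulrDr.
by rewrite big_split/= lerD.
Qed.

Lemma lrnorm_sum (I : Type) (s : seq I) (P : pred I) (F : I -> 'cV[R]_d) :
  N (\sum_(i <- s | P i) F i) <= \sum_(i <- s | P i) N (F i).
Proof.
elim/big_rec2 : _ => [|i y1 y2 _ h]; first by rewrite lrnorm0.
by apply: (le_trans (lrnormD _ _)); rewrite lerD2l.
Qed.

Lemma lrnorm_delta i : N (delta_mx i 0 : 'cV[R]_d) <= 1.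
Proof.
move: r1; rewrite /lrnorm; case: r => [s| |]//.
- rewrite lee_fin => s1; have s0 : s != 0 by rewrite gt_eqF//; lra.
  rewrite (bigD1 i)//= !mxE !eqxx normr1 powR1 big1 ?addr0 ?powR1//.
  by move=> j /negbTE ji; rewrite !mxE ji normr0 powR0.
- move=> _; apply: bigmax_le => // j _; rewrite !mxE eqxx andbT.
  by case: (_ == _); rewrite ?normr1 ?normr0.
Qed.

Lemma lrnorm_le_sum x : N x <= \sum_i `|x i 0|.
Proof.
have {1}-> : x = \sum_i x i 0 *: delta_mx i 0.
  apply/matrixP => i j; rewrite ord1 summxE (bigD1 i)//= big1 ?addr0.
    by rewrite !mxE !eqxx mulr1.
  by move=> k ki; rewrite !mxE eq_sym (negbTE ki) mulr0.
apply: (le_trans (lrnorm_sum _ _ _)); apply: ler_sum => i _.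
by rewrite lrnormZ ler_piMr// lrnorm_delta.
Qed.

(** Chain rule: the norming functional at [v], multiplied by the derivative of the power at the
    value of the norm. It drives the proof of Jensen's inequality on cells. *)
Lemma lrnorm_powR_subgradient p v : 1 <= p -> exists g : 'I_d -> R,
  forall x, N v `^ p + \sum_i g i * (x i 0 - v i 0) <= N x `^ p.
Proof.
move=> p1; have [l [lv lx]] := lrnorm_support v.
exists (fun i => p * N v `^ (p - 1) * l i) => x.
apply: le_trans (powR_tangent p1 (lrnorm_ge0 v) (lrnorm_ge0 x)); rewrite lerD2l.
rewrite (eq_bigr (fun i => p * N v `^ (p - 1) * (l i * (x i 0 - v i 0)))); last first.
  by move=> i _; rewrite mulrA.
rewrite -mulr_sumr ler_wpM2l//; first by rewrite mulr_ge0 ?powR_ge0//; lra.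
under eq_bigr do rewrite mulrBr.
by rewrite sumrB lv lerB.
Qed.

End lrnorm_theory.

(** * Random vectors and their L^p norm *)

Section measurable_colvectors.
Context (R : realType) (d : nat).

Lemma measurable_coord (i : 'I_d) : measurable_fun setT (fun x : 'cV[R]_d => x i 0).
Proof.
move=> _ Y mY; rewrite setTI; apply: sub_sigma_algebra => /=.
rewrite -bigcup_seq/=; exists i => /=; first by rewrite mem_index_enum.
by exists Y => //; rewrite setTI.
Qed.

Lemma measurable_box (A : 'I_d -> set R) : (forall i, measurable (A i)) ->
  measurable [set x : 'cV[R]_d | forall i, A i (x i 0)].
Proof.
move=> mA; rewrite (_ : mkset _ = \bigcap_(i in [set: 'I_d]) ((fun x : 'cV[R]_d => x i 0) @^-1` A i)).
  apply: fin_bigcap_measurable => [|i _]; first exact: finite_finset.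
  by rewrite -[X in measurable X]setTI; exact: measurable_coord.
by apply/seteqP; split => x /= h i; [move=> _|]; exact: h.
Qed.

Lemma measurable_cVP (dO : measure_display) (O : measurableType dO) (f : O -> 'cV[R]_d) :
  measurable_fun setT f <-> forall i, measurable_fun setT (fun w => f w i 0).
Proof.
split=> [mf i|mf].
  exact: (measurableT_comp (@measurable_coord i) mf).
apply: (@measurability _ _ _ _ _ _
  (\big[setU/set0]_(i < d) preimage_set_system setT (fun x : 'cV[R]_d => x i 0) measurable)) => //.
move=> _ [A + <-]; rewrite -bigcup_seq/= => -[i _ [B mB <-]].
by rewrite !setTI; have := mf i measurableT _ mB; rewrite setTI.
Qed.

Lemma measurable_lrnorm (r : \bar R) : measurable_fun setT (@lrnorm R d r).
Proof.
rewrite /lrnorm; case: r => [r| |]; last exact: measurable_cst.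
  apply: (measurableT_comp (measurable_powR _)).
  apply: measurable_sum => i; apply: (measurableT_comp (measurable_powR _)).
  by apply: measurableT_comp => //; exact: measurable_coord.
elim: (index_enum _) => [|i s ih].
  by under eq_fun do rewrite big_nil; exact: measurable_cst.
under eq_fun do rewrite big_cons; apply: measurable_maxr => //.
by apply: measurableT_comp => //; exact: measurable_coord.
Qed.

Context (dO : measure_display) (O : measurableType dO).
Implicit Types f g : O -> 'cV[R]_d.

Lemma measurable_cVD f g : measurable_fun setT f -> measurable_fun setT g ->
  measurable_fun setT (fun w => f w + g w).
Proof.
move=> /measurable_cVP mf /measurable_cVP mg; apply/measurable_cVP => i.
by under eq_fun do rewrite mxE; exact: measurable_funD.
Qed.

Lemma measurable_cVZ (h : O -> R) f : measurable_fun setT h -> measurable_fun setT f ->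
  measurable_fun setT (fun w => h w *: f w).
Proof.
move=> mh /measurable_cVP mf; apply/measurable_cVP => i.
by under eq_fun do rewrite mxE; exact: measurable_funM.
Qed.

Lemma measurable_cVB f g : measurable_fun setT f -> measurable_fun setT g ->
  measurable_fun setT (fun w => f w - g w).
Proof.
move=> /measurable_cVP mf /measurable_cVP mg; apply/measurable_cVP => i.
by under eq_fun do rewrite !mxE; exact: measurable_funB.
Qed.

End measurable_colvectors.

Lemma measurable_mulmx (R : realType) (d n : nat) (dO : measure_display)
  (O : measurableType dO) (A : 'M[R]_(n, d)) (f : O -> 'cV[R]_d) : measurable_fun setT f ->
  measurable_fun setT (fun w => A *m f w).
Proof.
move=> /measurable_cVP mf; apply/measurable_cVP => i.
under eq_fun do rewrite mxE; apply: measurable_sum => j.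
by apply: measurable_funM => //; exact: measurable_cst.
Qed.

Section preserves.
Context (R : realType).

(** Bare set functions are taken so that one notion serves the copies of a space inside a chain, the
    laws of random vectors, and translations of Lebesgue measure. *)
Definition preserves (dS dO : measure_display) (S : measurableType dS)
  (O : measurableType dO) (Q : set S -> \bar R) (P : set O -> \bar R) (X : S -> O) :=
  measurable_fun setT X /\ forall A, measurable A -> Q (X @^-1` A) = P A.

Context (dS dO : measure_display) (S : measurableType dS) (O : measurableType dO)
  (Q : {measure set S -> \bar R}) (P : {measure set O -> \bar R}) (X : S -> O).

Lemma ge0_integral_preserves (f : O -> \bar R) : preserves Q P X ->
  measurable_fun setT f -> (forall w, 0 <= f w)%E ->
  (\int[Q]_s f (X s) = \int[P]_w f w)%E.
Proof.
move=> [mX QP] mf f0.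
have := @ge0_integral_pushforward _ _ S O R X mX Q setT f measurableT mf (fun y _ => f0 y).
rewrite preimage_setT => <-.
by apply: (eq_measure_integral P) => A mA _; rewrite /= /pushforward/= QP.
Qed.

End preserves.

Lemma eq_poweR (R : realType) (x y : \bar R) (a : R) : x = y -> (x `^ a = y `^ a)%E.
Proof. by move=> ->. Qed.

Section LpNorm_theory.
Context (R : realType) (d : nat) (dO : measure_display) (O : measurableType dO)
  (P : probability O R) (p : R) (r : \bar R).
Hypotheses (p1 : 1 <= p) (r1 : (1 <= r)%E).
Implicit Types X Y : O -> 'cV[R]_d.
Local Notation L := (LpNorm P p r).
Local Open Scope ereal_scope.

Let p0 : (0 < p)%R. Proof. by apply: lt_le_trans p1. Qed.

Lemma LpNormE X : L X = (\int[P]_w (lrnorm r (X w) `^ p)%:E) `^ p^-1.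
Proof.
rewrite /LpNorm unlock.
apply: eq_poweR; apply: eq_integral => w _ /=.
by rewrite ger0_norm ?lrnorm_ge0// poweR_EFin.
Qed.

Lemma LpNorm_ge0 X : 0 <= L X.
Proof. exact: Lnorm_ge0. Qed.

Lemma LpNorm_powR X : L X `^ p = \int[P]_w (lrnorm r (X w) `^ p)%:E.
Proof.
rewrite LpNormE -poweRrM mulVf ?gt_eqF// poweRe1//.
by apply: integral_ge0 => w _; rewrite lee_fin powR_ge0.
Qed.

Lemma measurable_lrnorm_powR X : measurable_fun setT X ->
  measurable_fun setT (fun w => (lrnorm r (X w) `^ p)%:E).
Proof.
move=> mX; apply/measurable_EFinP; apply: (measurableT_comp (measurable_powR _)).
exact: (measurableT_comp (@measurable_lrnorm _ _ _)).
Qed.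

Lemma le_poweR (x y : \bar R) (a : R) : (0 <= a)%R -> 0 <= x -> x <= y -> x `^ a <= y `^ a.
Proof.
move=> a0 x0 xy; apply: gt0_ler_poweR => //; rewrite in_itv/= leey andbT//.
exact: le_trans xy.
Qed.

Lemma LpNormD X Y : measurable_fun setT X -> measurable_fun setT Y ->
  L (fun w => (X w + Y w)%R) <= L X + L Y.
Proof.
move=> mX mY.
have mN (Z : O -> 'cV[R]_d) : measurable_fun setT Z ->
    measurable_fun setT (fun w => lrnorm r (Z w)).
  by move=> mZ; exact: (measurableT_comp (@measurable_lrnorm _ _ _) mZ).
apply: le_trans (minkowski_EFin P (mN _ mX) (mN _ mY) p1).
rewrite LpNormE unlock; apply: le_poweR; first by rewrite invr_ge0 ltW.
  by apply: integral_ge0 => w _; rewrite lee_fin powR_ge0.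
apply: ge0_le_integral => //.
- by move=> w _; rewrite lee_fin powR_ge0.
- by apply: measurable_lrnorm_powR; exact: measurable_cVD.
- rewrite (_ : (fun _ => _) = fun w => (`|lrnorm r (X w) + lrnorm r (Y w)| `^ p)%:E); last first.
    by apply/funext => w; rewrite -poweR_EFin.
  apply/measurable_EFinP; apply: (measurableT_comp (measurable_powR _)).
  by apply: measurableT_comp => //; apply: measurable_funD; exact: mN.
- move=> w _; rewrite [leRHS](_ : _ = (`|lrnorm r (X w) + lrnorm r (Y w)| `^ p)%:E); last first.
    by rewrite -poweR_EFin.
  rewrite lee_fin.
  rewrite ger0_norm ?addr_ge0 ?lrnorm_ge0//.
  apply: ge0_ler_powR; rewrite ?nnegrE ?addr_ge0 ?lrnorm_ge0 ?lrnormD//.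
  exact: ltW.
Qed.

Lemma LpNormZ (a : R) X : measurable_fun setT X ->
  L (fun w => (a *: X w)%R) = `|a|%:E * L X.
Proof.
move=> mX; rewrite !LpNormE.
under eq_integral => w _ do rewrite lrnormZ// powRM ?lrnorm_ge0// EFinM.
rewrite ge0_integralZl ?lee_fin ?powR_ge0//; last 2 first.
- exact: measurable_lrnorm_powR.
- by move=> w _; rewrite lee_fin powR_ge0.
rewrite poweRM ?lee_fin ?powR_ge0//; last first.
- by apply: integral_ge0 => w _; rewrite lee_fin powR_ge0.
by rewrite poweR_EFin -powRrM mulfV ?gt_eqF// powRr1.
Qed.

Lemma LpNormN X : L (fun w => (- X w)%R) = L X.
Proof.
rewrite [LHS]LpNormE [RHS]LpNormE.
by apply: eq_poweR; under eq_integral => w _ do rewrite lrnormN//.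
Qed.

Lemma LpNorm_cst0 : L (fun=> (0%R : 'cV[R]_d)) = 0.
Proof.
rewrite LpNormE; under eq_integral do rewrite lrnorm0// powR0 ?gt_eqF//.
by rewrite integral0 poweR0r// invr_neq0// gt_eqF.
Qed.

Lemma LpNorm_sum (I : Type) (s : seq I) (F : I -> O -> 'cV[R]_d) :
  (forall i, measurable_fun setT (F i)) ->
  L (fun w => \sum_(i <- s) F i w)%R <= \sum_(i <- s) L (F i).
Proof.
move=> mF.
have mS s' : measurable_fun setT (fun w => \sum_(i <- s') F i w)%R.
  elim: s' => [|i s' ih].
    by under eq_fun do rewrite big_nil; exact: measurable_cst.
  by under eq_fun do rewrite big_cons; exact: measurable_cVD.
elim: s => [|i s ih].
  by under eq_fun do rewrite big_nil; rewrite big_nil LpNorm_cst0.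
under eq_fun do rewrite big_cons; rewrite big_cons.
by apply: (le_trans (LpNormD (mF i) (mS s))); exact: leeD2l.
Qed.

Lemma LpNorm_bound X (a : R) : measurable_fun setT X -> (0 <= a)%R ->
  {ae P, forall w, (lrnorm r (X w) <= a)%R} -> L X <= a%:E.
Proof.
move=> mX a0 Xa.
have aE : a%:E = (\int[P]_w (a `^ p)%:E) `^ p^-1.
  rewrite integral_cst//.
  rewrite [X in _ * X](@probability_setT _ _ _ P).
  rewrite mule1 poweR_EFin -powRrM mulfV ?gt_eqF//.
  by rewrite powRr1.
rewrite LpNormE aE; apply: le_poweR.
- by rewrite invr_ge0 ltW.
- by apply: integral_ge0 => w _; rewrite lee_fin powR_ge0.
apply: ae_ge0_le_integral => //.
- by move=> w _; rewrite lee_fin powR_ge0.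
- exact: measurable_lrnorm_powR.
- by move=> w _; rewrite lee_fin powR_ge0.
- apply: filterS Xa => w Xa _; rewrite lee_fin.
  by apply: ge0_ler_powR => //; rewrite ?nnegrE ?lrnorm_ge0// ltW.
Qed.

Lemma LpNorm_coord X i : measurable_fun setT X -> L X < +oo ->
  \int[P]_w (`|X w i 0| `^ p)%:E < +oo.
Proof.
move=> mX LX; apply: (@le_lt_trans _ _ (L X `^ p)); last exact: poweR_lty.
rewrite LpNorm_powR; apply: ge0_le_integral => //.
- apply/measurable_EFinP; apply: (measurableT_comp (measurable_powR _)).
  by apply: measurableT_comp => //; exact: (measurable_cVP _).1.
- exact: measurable_lrnorm_powR.
- move=> w _; rewrite lee_fin.
  by apply: ge0_ler_powR => //; rewrite ?nnegrE ?lrnorm_ge0 ?le_coord_lrnorm// ltW.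
Qed.

End LpNorm_theory.

Lemma LpNorm_preserves (R : realType) (d : nat) (p : R) (r : \bar R)
  (dS dO : measure_display) (S : measurableType dS) (O : measurableType dO)
  (Q : probability S R) (P : probability O R) (X : S -> O) (f : O -> 'cV[R]_d) :
  (1 <= r)%E -> preserves Q P X -> measurable_fun setT f ->
  LpNorm Q p r (fun s => f (X s)) = LpNorm P p r f.
Proof.
move=> r1 QP mf; rewrite !LpNormE//; apply: eq_poweR.
apply: (ge0_integral_preserves (f := fun w => (lrnorm r (f w) `^ p)%:E)) => //.
  exact: measurable_lrnorm_powR.
by move=> w; rewrite lee_fin powR_ge0.
Qed.

(** * Cell means *)

Section cell_mean.
Context (R : realType) (dO : measure_display) (O : measurableType dO)
  (P : probability O R) (k : O -> nat).
Hypothesis mk : measurable_fun setT k.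
Implicit Types f g : O -> R.
Local Notation cell c := (k @^-1` [set c]).

Lemma measurable_cell c : measurable (cell c).
Proof. by rewrite -[cell c]setTI; exact: mk. Qed.

(* On a null cell the division by zero makes this 0. *)
Definition cell_mean f (w : O) : R :=
  (\int[P]_(x in cell (k w)) f x) / fine (P (cell (k w))).

Lemma measurable_cell_mean f : measurable_fun setT (cell_mean f).
Proof.
exact: (measurableT_comp (f := fun c : nat =>
  (\int[P]_(x in cell c) f x) / fine (P (cell c))) _ mk).
Qed.

(** On a null cell the integral of [f] vanishes too, so the default value 0 of the mean is
    harmless. *)
Lemma cell_mean_int f c : P.-integrable setT (EFin \o f) ->
  (\int[P]_(x in cell c) f x) = \int[P]_(x in cell c) cell_mean f x.
Proof.
move=> intf.
rewrite (@eq_Rintegral _ _ _ P (cell c) (fun=> (\int[P]_(x in cell c) f x) / fine (P (cell c))) (cell_mean f)).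
  rewrite Rintegral_cst; last exact: measurable_cell.
  have [P0|P0] := eqVneq (fine (P (cell c))) 0; last by rewrite divfK.
  rewrite P0 mulr0.
  have Pc0 : P (cell c) = 0%E.
    by rewrite -(@fineK _ (P (cell c))) ?P0// fin_num_measure//; exact: measurable_cell.
  rewrite /Rintegral null_set_integral//; first exact: measurable_cell.
  by apply: measurable_funTS; exact: measurable_int intf.
by move=> w; rewrite inE /= => <-.
Qed.

Lemma cell_mean_bound f (a : R) : measurable_fun setT f -> (forall w, `|f w| <= a) ->
  forall w, `|cell_mean f w| <= a.
Proof.
move=> mf fa w.
have a0 : 0 <= a by apply: le_trans (fa w).
have mc := measurable_cell (k w).
have intf : P.-integrable (cell (k w)) (EFin \o f).
  apply: (@integrableS _ _ _ _ setT) => //.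
  apply: (@le_integrable _ _ _ _ _ _ _ (EFin \o cst a)) => //.
  - exact/measurable_EFinP.
  - by move=> x _; rewrite /= lee_fin (ger0_norm a0).
  - exact: finite_measure_integrable_cst.
have Pw0 : 0 <= fine (P (cell (k w))) by rewrite fine_ge0.
rewrite /cell_mean normrM normfV (ger0_norm Pw0).
have [->|P0] := eqVneq (fine (P (cell (k w)))) 0; first by rewrite invr0 mulr0.
rewrite ler_pdivrMr ?lt_neqAle ?(eq_sym 0) ?P0 ?Pw0//.
apply: (le_trans (le_normr_Rintegral mc intf)).
rewrite -Rintegral_cst//; apply: le_Rintegral => //.
- exact: integrable_norm.
- exact: finite_measure_integrable_cst.
Qed.

Lemma integrable_cell_mean f : measurable_fun setT f -> (exists a, forall w, `|f w| <= a) ->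
  P.-integrable setT (EFin \o cell_mean f).
Proof.
move=> mf [a fa].
apply: (@le_integrable _ _ _ _ _ _ _ (EFin \o cst a)) => //.
- exact/measurable_EFinP/measurable_cell_mean.
- by move=> x _; rewrite /= lee_fin (le_trans (cell_mean_bound mf fa _))// ler_norm.
- exact: finite_measure_integrable_cst.
Qed.

Lemma cell_meanD f g w : P.-integrable setT (EFin \o f) -> P.-integrable setT (EFin \o g) ->
  cell_mean (fun x => f x + g x) w = cell_mean f w + cell_mean g w.
Proof.
move=> intf intg; rewrite /cell_mean RintegralD ?mulrDl//; first exact: measurable_cell.
- by apply: integrableS intf => //; exact: measurable_cell.
- by apply: integrableS intg => //; exact: measurable_cell.
Qed.

Lemma cell_meanZ (a : R) f w : P.-integrable setT (EFin \o f) ->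
  cell_mean (fun x => a * f x) w = a * cell_mean f w.
Proof.
move=> intf; rewrite /cell_mean RintegralZl ?mulrA//; first exact: measurable_cell.
by apply: integrableS intf => //; exact: measurable_cell.
Qed.

Lemma ge0_integral_cells (f : O -> \bar R) : measurable_fun setT f -> (forall w, 0 <= f w)%E ->
  (\int[P]_w f w = \sum_(c <oo) \int[P]_(w in cell c) f w)%E.
Proof.
move=> mf f0.
have UE : \bigcup_c cell c = setT.
  by rewrite -subTset => w _; exists (k w).
rewrite -[in LHS]UE ge0_integral_bigcup//.
- by move=> c; exact: measurable_cell.
- by rewrite UE.
- apply/trivIsetP => i j _ _ ij; rewrite -preimage_setI; apply/seteqP; split => // w [/= -> /eqP].
  by rewrite (negbTE ij).
Qed.

End cell_mean.

Section cell_mean_vec.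
Context (R : realType) (dO : measure_display) (O : measurableType dO)
  (P : probability O R) (k : O -> nat) (d : nat).
Hypothesis mk : measurable_fun setT k.
Implicit Types X Y : O -> 'cV[R]_d.
Local Notation cell c := (k @^-1` [set c]).

Definition integrable_vec X := forall i, P.-integrable setT (fun w => (X w i 0)%:E).

Definition cell_mean_vec X (w : O) : 'cV[R]_d :=
  \col_i cell_mean P k (fun x => X x i 0) w.

Lemma measurable_cell_mean_vec X : measurable_fun setT (cell_mean_vec X).
Proof.
apply/measurable_cVP => i; under eq_fun do rewrite mxE; exact: measurable_cell_mean.
Qed.

Lemma measurable_integrable_vec X : integrable_vec X -> measurable_fun setT X.
Proof.
by move=> iX; apply/measurable_cVP => i; apply/measurable_EFinP; exact: measurable_int (iX i).
Qed.

Lemma cell_mean_vecD X Y : integrable_vec X -> integrable_vec Y ->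
  cell_mean_vec (fun x => X x + Y x) = (fun w => cell_mean_vec X w + cell_mean_vec Y w).
Proof.
move=> iX iY; apply/funext => w; apply/matrixP => i j; rewrite !mxE -cell_meanD//.
- by congr cell_mean; apply/funext => x; rewrite mxE.
- exact: iX.
- exact: iY.
Qed.

Lemma cell_mean_vecZ (a : R) X : integrable_vec X ->
  cell_mean_vec (fun x => a *: X x) = (fun w => a *: cell_mean_vec X w).
Proof.
move=> iX; apply/funext => w; apply/matrixP => i j; rewrite !mxE -cell_meanZ//.
- by congr cell_mean; apply/funext => x; rewrite mxE.
- exact: iX.
Qed.

(** Lets a vector be replaced by its conditional expectation given a sigma-algebra that contains the
    cells. *)
Lemma cell_mean_vec_eq X Y :
  (forall c i, \int[P]_(x in cell c) X x i 0 = \int[P]_(x in cell c) Y x i 0) ->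
  cell_mean_vec X = cell_mean_vec Y.
Proof.
by move=> XY; apply/funext => w; apply/matrixP => i j; rewrite !mxE /cell_mean XY.
Qed.

Context (p : R) (r : \bar R).
Hypotheses (p1 : 1 <= p) (r1 : (1 <= r)%E).

(* Jensen on a single cell, integrating a subgradient of [lrnorm r ^ p] at the cell mean. *)
Lemma cell_jensen X c : integrable_vec X ->
  (\int[P]_(w in cell c) (lrnorm r (cell_mean_vec X w) `^ p)%:E <=
   \int[P]_(w in cell c) (lrnorm r (X w) `^ p)%:E)%E.
Proof.
move=> iX.
have mc := measurable_cell mk c.
have [[w0 w0c]|nw] := pselect (exists w, k w = c); last first.
  suff -> : cell c = set0 by rewrite !integral_set0.
  by apply/seteqP; split => // w wc; apply: nw; exists w.
(* An infinite right-hand side is trivial; a finite one gives the integrability that [le_integral]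
   asks for. *)
have [->|Xoo] := eqVneq (\int[P]_(w in cell c) (lrnorm r (X w) `^ p)%:E)%E +oo%E.
  by rewrite leey.
pose e := cell_mean_vec X w0.
have eE w : cell c w -> cell_mean_vec X w = e.
  by move=> /= wc; apply/matrixP => i j; rewrite !mxE /cell_mean wc w0c.
rewrite (_ : (\int[P]_(w in cell c) (lrnorm r (cell_mean_vec X w) `^ p)%:E)%E =
             (\int[P]_(w in cell c) (lrnorm r e `^ p)%:E)%E); last first.
  by apply: eq_integral => w; rewrite inE => /eE ->.
have [g gX] := lrnorm_powR_subgradient r1 e p1.
have iXc i : P.-integrable (cell c) (EFin \o (fun w => X w i 0)).
  by apply: integrableS (iX i).
have iXe i : P.-integrable (cell c) (EFin \o (fun w => g i * (X w i 0 - e i 0))).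
  have := integrableZl mc (g i) (integrableB mc (iXc i) (finite_measure_integrable_cst P (e i 0) mc)).
  by apply: eq_integrable.
(* The linear part of the subgradient inequality integrates to 0 because [e] is the mean over the
   cell. *)
have h0 : (\int[P]_(w in cell c) (\sum_i (g i * (X w i 0 - e i 0))%:E) = 0)%E.
  rewrite integral_sum//; apply: big1 => i _.
  have -> : (\int[P]_(w in cell c) (g i * (X w i 0 - e i 0))%:E =
      (\int[P]_(w in cell c) (g i * (X w i 0 - e i 0)))%:E)%E.
    by rewrite /Rintegral fineK//; exact: (integrable_fin_num mc (iXe i)).
  rewrite RintegralZl//; last first.
    exact: (integrableB mc (iXc i) (finite_measure_integrable_cst P (e i 0) mc)).
  rewrite RintegralB//; last exact: (finite_measure_integrable_cst P (e i 0) mc).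
  rewrite (cell_mean_int mk c (iX i)).
  rewrite (@eq_Rintegral _ _ _ P (cell c) (fun=> e i 0) (cell_mean P k (fun x => X x i 0))).
    by rewrite subrr mulr0.
  by move=> w; rewrite inE => /eE/matrixP/(_ i 0); rewrite mxE.
have icst : P.-integrable (cell c) (fun=> (lrnorm r e `^ p)%:E).
  exact: (finite_measure_integrable_cst P (lrnorm r e `^ p) mc).
have isum : P.-integrable (cell c) (fun w => \sum_i (g i * (X w i 0 - e i 0))%:E)%E.
  by apply: integrable_sum => // i _; exact: iXe.
have -> : (\int[P]_(w in cell c) (lrnorm r e `^ p)%:E =
   \int[P]_(w in cell c) ((lrnorm r e `^ p)%:E + \sum_i (g i * (X w i 0 - e i 0))%:E))%E.
  by rewrite integralD// h0 adde0.
apply: le_integral => //.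
- exact: integrableD.
- apply/integrableP; split.
    by apply: measurable_funTS; apply: measurable_lrnorm_powR; exact: measurable_integrable_vec.
  rewrite ltey; apply: contra Xoo => /eqP Xoo; apply/eqP; rewrite -[RHS]Xoo.
  by apply: eq_integral => w _; rewrite gee0_abs// lee_fin powR_ge0.
- by move=> w _; rewrite sumEFin -EFinD lee_fin.
Qed.

Lemma LpNorm_cell_mean X : integrable_vec X ->
  (LpNorm P p r (cell_mean_vec X) <= LpNorm P p r X)%E.
Proof.
move=> iX; rewrite (LpNormE P p r X) (LpNormE P p r (cell_mean_vec X)).
apply: le_poweR.
- by rewrite invr_ge0 (le_trans _ p1).
- by apply: integral_ge0 => w _; rewrite lee_fin powR_ge0.
have mX := measurable_integrable_vec iX.
rewrite (ge0_integral_cells P mk (measurable_lrnorm_powR p r (measurable_cell_mean_vec X))); last first.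
  by move=> w; rewrite lee_fin powR_ge0.
rewrite (ge0_integral_cells P mk (measurable_lrnorm_powR p r mX)); last first.
  by move=> w; rewrite lee_fin powR_ge0.
apply: lee_nneseries => [c _ _|c _].
  by apply: integral_ge0 => w _; rewrite lee_fin powR_ge0.
exact: cell_jensen.
Qed.

End cell_mean_vec.

(** * Gluing two spaces along a countable partition *)

Section probability_of_measure.
Context (R : realType) (dT : measure_display) (T : measurableType dT).
Variables (m : {measure set T -> \bar R}) (m1 : m setT = 1%E).

(** The [let] makes the term carry [m1], so that its probability structure can be inferred from the
    term alone. *)
Definition probability_of_measure : set T -> \bar R := let _ := m1 in m.
HB.instance Definition _ := Measure.on probability_of_measure.
HB.instance Definition _ :=
  Measure_isProbability.Build _ _ _ probability_of_measure m1.

End probability_of_measure.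

Lemma ge0_integral_mrestr (R : realType) (dT : measure_display) (T : measurableType dT)
  (m : {measure set T -> \bar R}) (D : set T) (mD : measurable D) (f : T -> \bar R) :
  measurable_fun setT f -> (forall x, 0 <= f x)%E ->
  (\int[mrestr m mD]_x f x = \int[m]_(x in D) f x)%E.
Proof.
move=> mf f0.
rewrite (@ge0_negligible_integral _ _ _ (mrestr m mD) setT (~` D))//; last 2 first.
- exact: measurableC.
- by rewrite /= /mrestr setICl measure0.
rewrite setTD setCK; apply: (eq_measure_integral m) => A mA AD.
by rewrite /= /mrestr classical_sets.setIidl.
Qed.

Section glue.
Context (R : realType) (dS dO : measure_display) (S : measurableType dS)
  (O : measurableType dO) (Q : probability S R) (P : probability O R)
  (k : S -> nat) (l : O -> nat).
Hypotheses (mk : measurable_fun setT k) (ml : measurable_fun setT l).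
Hypothesis kl : forall c, Q (k @^-1` [set c]) = P (l @^-1` [set c]).
Local Open Scope ereal_scope.

Let K c := k @^-1` [set c].
Let L c := l @^-1` [set c].
Let mK c : measurable (K c). Proof. exact: measurable_cell. Qed.
Let mL c : measurable (L c). Proof. exact: measurable_cell. Qed.
Let mKL c : measurable (K c `*` L c). Proof. exact: measurableX. Qed.

Let UK : \bigcup_c K c = setT.
Proof. by rewrite -subTset => w _; exists (k w). Qed.

Let UL : \bigcup_c L c = setT.
Proof. by rewrite -subTset => w _; exists (l w). Qed.

Let tK : trivIset setT K.
Proof.
by apply/trivIsetP => i j _ _ ij; apply/seteqP; split => // w [/= ki kj]; move: ij; rewrite -ki -kj eqxx.
Qed.

Let tL : trivIset setT L.
Proof.
by apply/trivIsetP => i j _ _ ij; apply/seteqP; split => // w [/= ki kj]; move: ij; rewrite -ki -kj eqxx.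
Qed.

Let wt_ge0 c : (0 <= (fine (P (L c)))^-1)%R.
Proof. by rewrite invr_ge0 fine_ge0. Qed.
Let wt c : {nonneg R} := NngNum (wt_ge0 c).

Let P_fin c : P (L c) = (fine (P (L c)))%:E.
Proof. by rewrite fineK// fin_num_measure. Qed.

Let klK c : Q (K c) = P (L c). Proof. exact: kl. Qed.

Let wtP c : P (L c) != 0 -> (fine (P (L c)))^-1%:E * P (L c) = 1.
Proof.
move=> P0; rewrite [X in _ * X]P_fin -EFinM mulVf//.
by apply: contra P0 => /eqP P0; rewrite P_fin P0.
Qed.

(* Given [k = l = c], the two coordinates are independent with their conditional laws; the weight
   [P (L c) / (Q (K c) * P (L c))] is [1 / P (L c)], and is 0 when [P (L c) = 0]. *)
Definition glue_measure : {measure set (S * O) -> \bar R} :=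
  mseries (fun c => mscale (wt c) (mrestr (Q \x P) (mKL c))) 0.

Let prodE A B : measurable A -> measurable B -> (Q \x P) (A `*` B) = Q A * P B.
Proof. exact: product_measure1E. Qed.

Let glue_fst A : measurable A -> glue_measure (A `*` setT) = Q A.
Proof.
move=> mA; rewrite /= /mseries/=.
transitivity (\sum_(c <oo) Q (A `&` K c)).
  apply: eq_eseriesr => c _; rewrite /mscale/= /mrestr -setXI setTI prodE//; last exact: measurableI.
  (* On a [P]-null cell the weight is 0, and nothing is lost: by [kl] the matching cell [K c] is
     [Q]-null. *)
  rewrite muleCA; have [P0|P0] := eqVneq (P (L c)) (0 : \bar R); last by rewrite wtP// mule1.
  rewrite P0 !mule0; apply/esym/eqP; rewrite -measure_le0 -P0 -klK.
  by apply: le_measure; rewrite ?inE//; exact: measurableI.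
rewrite -[in RHS](setIT A) -UK setI_bigcupr measure_bigcup//; last 2 first.
- by move=> c _; exact: measurableI.
- exact: trivIset_setIl.
by apply: eq_eseriesl => c; apply/esym/mem_set.
Qed.

Let glue_snd A : measurable A -> glue_measure (setT `*` A) = P A.
Proof.
move=> mA; rewrite /= /mseries/=.
transitivity (\sum_(c <oo) P (A `&` L c)).
  apply: eq_eseriesr => c _; rewrite /mscale/= /mrestr -setXI setTI prodE//; last exact: measurableI.
  rewrite muleA klK.
  have [P0|P0] := eqVneq (P (L c)) (0 : \bar R); last by rewrite wtP// mul1e.
  rewrite P0 mule0 mul0e; apply/esym/eqP; rewrite -measure_le0 -P0.
  by apply: le_measure; rewrite ?inE//; exact: measurableI.
rewrite -[in RHS](setIT A) -UL setI_bigcupr measure_bigcup//; last 2 first.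
- by move=> c _; exact: measurableI.
- exact: trivIset_setIl.
by apply: eq_eseriesl => c; apply/esym/mem_set.
Qed.

Let glue_setT : glue_measure setT = 1.
Proof. by rewrite -setXTT glue_fst// probability_setT. Qed.

Let glue_diag : glue_measure [set z | k z.1 != l z.2] = 0.
Proof.
rewrite /= /mseries/=; apply: eseries0 => c _ _.
rewrite /mscale/= /mrestr (_ : _ `&` _ = set0) ?measure0 ?mule0//.
apply/seteqP; split => // -[s w] [/= + [ks lw]].
by rewrite (ks : k s = c) (lw : l w = c) eqxx.
Qed.

Let ge0_integral_glue (h : S * O -> \bar R) : measurable_fun setT h -> (forall z, 0 <= h z) ->
  \int[glue_measure]_z h z = \sum_(c <oo) (fine (P (L c)))^-1%:E *
    \int[Q]_(s in K c) \int[P]_(w in L c) h (s, w).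
Proof.
move=> mh h0; rewrite ge0_integral_measure_series//.
apply: eq_eseriesr => c _; rewrite ge0_integral_mscale//; congr (_ * _).
rewrite ge0_integral_mrestr// integral_mkcond fubini_tonelli1; last 2 first.
- exact: ((measurable_restrictT h (mKL c)).1 (measurable_funTS mh)).
- by move=> z; apply: erestrict_ge0.
rewrite [RHS]integral_mkcond; apply: eq_integral => s _.
rewrite /fubini_F patchE; case: ifPn => sK.
  rewrite [RHS]integral_mkcond; apply: eq_integral => w _.
  rewrite !patchE; congr (if _ then _ else _).
  by apply/idP/idP; rewrite !inE/=; [case|move: sK; rewrite inE].
apply: integral0_eq => w _; rewrite patchE ifF//.
by apply/negbTE; apply: contra sK; rewrite !inE => -[].
Qed.

(** On each block the two coordinates are conditionally independent and [g] has mean zero, so the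
    cross term vanishes. The identity is read in [[0, +oo]], since [f] need not be square
    integrable. *)
Let glue_sqr (f : S -> R) (g : O -> R) :
  measurable_fun setT f -> measurable_fun setT g -> (exists a : R, forall w, `|g w| <= a)%R ->
  (forall c, (\int[P]_(w in L c) g w)%R = 0%R) ->
  \int[glue_measure]_z ((f z.1 + g z.2) ^+ 2)%:E =
  \int[Q]_s (f s ^+ 2)%:E + \int[P]_w (g w ^+ 2)%:E.
Proof.
move=> mf mg [a ga] g0.
have mf2 : measurable_fun setT (fun s => (f s ^+ 2)%:E).
  by apply/measurable_EFinP; exact: measurable_funX.
have mg2 : measurable_fun setT (fun s => (g s ^+ 2)%:E).
  by apply/measurable_EFinP; exact: measurable_funX.
rewrite ge0_integral_glue; last 2 first.
- apply/measurable_EFinP; apply: measurable_funX; apply: measurable_funD.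
    exact: (measurableT_comp mf).
  exact: (measurableT_comp mg).
- by move=> z; rewrite lee_fin sqr_ge0.
rewrite (ge0_integral_cells Q mk mf2); last by move=> s; rewrite lee_fin sqr_ge0.
rewrite (ge0_integral_cells P ml mg2); last by move=> s; rewrite lee_fin sqr_ge0.
rewrite -nneseriesD; last 2 first.
- by move=> c _ _; apply: integral_ge0 => s _; rewrite lee_fin sqr_ge0.
- by move=> c _ _; apply: integral_ge0 => s _; rewrite lee_fin sqr_ge0.
apply: eq_eseriesr => c _; rewrite -/(K c) -/(L c).
have ig : P.-integrable (L c) (EFin \o g).
  apply: (@le_integrable _ _ _ _ _ _ _ (EFin \o cst a)) => //.
  - by apply: measurable_funTS; exact/measurable_EFinP.
  - by move=> x _; rewrite /= lee_fin (le_trans (ga _))// ler_norm.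
  - exact: finite_measure_integrable_cst.
have ig2 : P.-integrable (L c) (fun w => (g w ^+ 2)%:E).
  apply: (@le_integrable _ _ _ _ _ _ _ (EFin \o cst (a ^+ 2)%R)) => //.
  - exact: measurable_funTS.
  - move=> x _; rewrite /= lee_fin !ger0_norm ?sqr_ge0//.
    by rewrite -[leLHS]real_normK ?num_real// lerXn2r ?nnegrE ?(le_trans _ (ga x)).
  - exact: finite_measure_integrable_cst.
(* With [s] fixed, [f s] is a constant and [g] is bounded, so the square may be expanded under the
   integral. *)
have inner s : \int[P]_(w in L c) ((f s + g w) ^+ 2)%:E =
    (f s ^+ 2)%:E * P (L c) + \int[P]_(w in L c) (g w ^+ 2)%:E.
  transitivity (\int[P]_(w in L c) ((f s ^+ 2)%:E + ((2 * f s)%:E * (g w)%:E + (g w ^+ 2)%:E))).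
    apply: eq_integral => w _; rewrite -EFinM -!EFinD; congr EFin; ring.
  rewrite integralD//; last 2 first.
  - exact: (finite_measure_integrable_cst P (f s ^+ 2)%R).
  - by apply: integrableD => //; exact: integrableZl.
  rewrite integral_cst//; congr (_ + _).
  rewrite integralD//; last exact: integrableZl.
  rewrite integralZl//.
  have -> : \int[P]_(w in L c) (g w)%:E = 0.
    by rewrite -[LHS]fineK ?[fine _]g0//; exact: integrable_fin_num.
  by rewrite mule0 add0e.
under eq_integral do rewrite inner.
have i0 : 0 <= \int[P]_(w in L c) (g w ^+ 2)%:E.
  by apply: integral_ge0 => w _; rewrite lee_fin sqr_ge0.
rewrite ge0_integralD//; last 2 first.
- by move=> s _; rewrite mule_ge0// lee_fin sqr_ge0.
- by apply: emeasurable_funM => //; exact: measurable_funTS.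
rewrite ge0_integralZr//; last 2 first.
- exact: measurable_funTS.
- by move=> s _; rewrite lee_fin sqr_ge0.
have iF : \int[P]_(w in L c) (g w ^+ 2)%:E \is a fin_num by exact: integrable_fin_num.
have -> : \int[Q]_(_ in K c) \int[P]_(w in L c) (g w ^+ 2)%:E =
    \int[P]_(w in L c) (g w ^+ 2)%:E * P (L c).
  by rewrite -klK -integral_cst.
rewrite -(fineK iF).
(* Null cells contribute 0 to both sides; elsewhere the weight [1 / P (L c)] cancels the common
   factor [P (L c)]. *)
have [P0|P0] := eqVneq (P (L c)) (0 : \bar R).
  rewrite P0 !mule0 adde0 mule0 null_set_integral//; last 2 first.
  - exact: measurable_funTS.
  - by rewrite -[RHS]P0; exact: klK.
  by rewrite fineK// null_set_integral ?adde0//; exact: measurable_funTS.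
rewrite -muleDl ?fin_num_measure//; last first.
  rewrite ge0_adde_def// inE; last by rewrite fineK.
  by apply: integral_ge0 => s _; rewrite lee_fin sqr_ge0.
by rewrite muleCA wtP// mule1.
Qed.

Lemma exists_glue : exists G : probability (S * O)%type R,
  [/\ preserves G Q fst, preserves G P snd, G [set z | k z.1 != l z.2] = 0 &
  forall (f : S -> R) (g : O -> R),
  measurable_fun setT f -> measurable_fun setT g -> (exists a : R, forall w, `|g w| <= a)%R ->
  (forall c, (\int[P]_(w in l @^-1` [set c]) g w)%R = 0%R) ->
  \int[G]_z ((f z.1 + g z.2) ^+ 2)%:E =
  \int[Q]_s (f s ^+ 2)%:E + \int[P]_w (g w ^+ 2)%:E].
Proof.
exists (probability_of_measure glue_setT); split.
- split=> // A mA; transitivity (glue_measure (A `*` setT)); last exact: glue_fst.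
  rewrite (_ : A `*` setT = fst @^-1` A)//.
  by apply/seteqP; split => [[s w] []|[s w]].
- split=> // A mA; transitivity (glue_measure (setT `*` A)); last exact: glue_snd.
  rewrite (_ : setT `*` A = snd @^-1` A)//.
  by apply/seteqP; split => [[s w] []|[s w]].
- exact: glue_diag.
- exact: glue_sqr.
Qed.

End glue.

(** * Chains of couplings *)

Section cube.
Context (R : realType) (d : nat).

(** The injective code [pickle] turns the integer vector of floors into a [nat], the countable kind
    of label that cell means and gluing use. *)
Definition cube (a : R) (x : 'cV[R]_d) : nat :=
  pickle [ffun i : 'I_d => Num.floor (x i 0 / a)].

Lemma measurable_cube (a : R) : measurable_fun setT (cube a).
Proof.
move=> _ Y _; rewrite setTI.
have -> : cube a @^-1` Y = \bigcup_(c in Y) (cube a @^-1` [set c]).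
  by apply/seteqP; split => [x Yx|x [m Ym /= xm]]; [exists (cube a x)|rewrite /= xm].
apply: bigcup_measurable => c _.
(* A natural number that codes no cube has empty preimage. *)
have [[x xc]|nx] := pselect (exists x, cube a x = c); last first.
  suff -> : cube a @^-1` [set c] = set0 by exact: measurable0.
  by apply/seteqP; split => // x xc; apply: nx; exists x.
have -> : cube a @^-1` [set c] = \bigcap_(i in [set: 'I_d])
    ((fun y : 'cV[R]_d => y i 0 / a) @^-1` [set` `[(Num.floor (x i 0 / a))%:~R, (Num.floor (x i 0 / a) + 1)%:~R[ ]).
  apply/seteqP; split => y /=.
    rewrite -xc => /(pcan_inj pickleK)/ffunP yx i _ /=.
    by have := yx i; rewrite !ffunE => <-; rewrite in_itv/= floor_le_tmp floorD1_gt.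
  move=> yx; rewrite -xc; congr pickle; apply/ffunP => i; rewrite !ffunE.
  have := yx i I; rewrite /= in_itv/= => /andP[h1 h2].
  by apply: floor_def; rewrite h1.
apply: fin_bigcap_measurable; first exact: finite_finset.
move=> i _; rewrite -[X in measurable X]setTI.
have : measurable_fun setT (fun y : 'cV[R]_d => y i 0 / a).
  apply: measurable_funM; [exact: measurable_coord|exact: measurable_cst].
by apply => //; exact: measurable_itv.
Qed.

(** The factor [d] comes from bounding every [l^r] norm by the [l^1] norm, uniformly in [r]. *)
Lemma cube_close (r : \bar R) (a : R) (x y : 'cV[R]_d) : (1 <= r)%E -> 0 < a ->
  cube a x = cube a y -> lrnorm r (x - y) <= d%:R * a.
Proof.
move=> r1 a0 /(pcan_inj pickleK)/ffunP xy.
apply: (le_trans (lrnorm_le_sum r1 _)).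
apply: (@le_trans _ _ (\sum_(i < d) a)); last by rewrite sumr_const card_ord mulr_natl.
apply: ler_sum => i _; rewrite !mxE.
have := xy i; rewrite !ffunE => xyi.
have hx1 := floor_le_tmp (x i 0 / a); have hx2 := floorD1_gt (x i 0 / a).
have hy1 := floor_le_tmp (y i 0 / a); have hy2 := floorD1_gt (y i 0 / a).
rewrite xyi in hx1 hx2.
move: hx1 hx2 hy1 hy2; rewrite rmorphD/= => hx1 hx2 hy1 hy2.
have : `|x i 0 / a - y i 0 / a| <= 1 by rewrite ler_norml; apply/andP; split; lra.
by rewrite -mulrBl normrM normfV (gtr0_norm a0) ler_pdivrMr// mul1r.
Qed.

End cube.

Lemma preserves_comp (R : realType) (d1 d2 d3 : measure_display)
  (T1 : measurableType d1) (T2 : measurableType d2) (T3 : measurableType d3)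
  (m1 : set T1 -> \bar R) (m2 : set T2 -> \bar R) (m3 : set T3 -> \bar R)
  (f : T1 -> T2) (g : T2 -> T3) :
  preserves m1 m2 f -> preserves m2 m3 g -> preserves m1 m3 (g \o f).
Proof.
move=> [mf pf] [mg pg]; split; first exact: measurableT_comp.
move=> A mA; rewrite -pg// -pf//.
by rewrite -[X in measurable X]setTI; exact: mg.
Qed.

Section chain.
Context (R : realType) (d : nat) (dO : measure_display) (O : measurableType dO)
  (P : probability O R) (p : R) (r : \bar R).
Hypotheses (p1 : 1 <= p) (r1 : (1 <= r)%E).
Variables (F D : nat -> O -> 'cV[R]_d) (c : nat -> R) (a : R).
Hypotheses (a0 : 0 < a) (mF : forall k, measurable_fun setT (F k))
  (mD : forall k, measurable_fun setT (D k))
  (Dc : forall k w i, `|D k w i 0| <= c k)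
  (D0 : forall k m i,
    \int[P]_(w in (fun w => cube a (F k w)) @^-1` [set m]) (D k w i 0) = 0).

(* [M] is the martingale part of the displacement along the chain: its increments [D k] have mean
   zero given the cube of [F k], hence are orthogonal. *)
Lemma chain n : exists (dS : measure_display) (S : measurableType dS) (Q : probability S R)
    (X0 X : S -> O) (M : S -> 'cV[R]_d),
  [/\ preserves Q P X0, preserves Q P X, measurable_fun setT M,
    (forall s i, `|M s i 0| <= \sum_(k < n) c k) /\
    (forall i, (\int[Q]_s (M s i 0 ^+ 2)%:E <= (\sum_(k < n) c k ^+ 2)%:E)%E) &
    (LpNorm Q p r (fun s => F n (X s) - F 0%N (X0 s) - M s)%R <=
     \sum_(k < n) LpNorm P p r (fun w => F k.+1 w - F k w - D k w)%R +
     (n%:R * (d%:R * a))%:E)%E].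
Proof.
elim: n => [|n [dS [S [Q [X0 [X [M [pX0 pX mM [Mb M2] LM]]]]]]]].
  exists dO, O, P, id, id, (fun=> 0); split => //.
    split => [s i|i]; first by rewrite big_ord0 mxE normr0.
    rewrite big_ord0; under eq_integral do rewrite mxE expr0n/=.
    by rewrite integral0.
  under eq_fun do rewrite subrr subr0.
  by rewrite LpNorm_cst0// big_ord0 mul0r adde0.
(* The last copy of the chain and the new copy of [O] are glued along the cube of [F n]; both labels
   have the same law because [X] preserves the measures. *)
pose k s := cube a (F n (X s)); pose l w := cube a (F n w).
have ml : measurable_fun setT l by exact: (measurableT_comp (measurable_cube a) (mF n)).
have mk : measurable_fun setT k by exact: (measurableT_comp ml pX.1).
have kl m : Q (k @^-1` [set m]) = P (l @^-1` [set m]).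
  by rewrite -pX.2//; exact: measurable_cell.
have [G [Gfst Gsnd Gdiag Gsqr]] := exists_glue mk ml kl.
have mfst := Gfst.1; have msnd := Gsnd.1.
exists _, (S * O)%type, G, (X0 \o fst), snd, (fun z => M z.1 + D n z.2); split.
- exact: preserves_comp Gfst pX0.
- exact: Gsnd.
- by apply: measurable_cVD; [exact: measurableT_comp mM mfst|exact: measurableT_comp (mD n) msnd].
- split => [z i|i].
    by rewrite mxE big_ord_recr/=; apply: (le_trans (ler_normD _ _)); rewrite lerD.
  under eq_integral do rewrite mxE.
  (* Orthogonality: [M] lives on the old chain, and [D n] has mean zero on every cell of the new
     copy. *)
  rewrite (Gsqr (fun s => M s i 0) (fun w => D n w i 0)); last 4 first.
  + exact: (measurable_cVP _).1.
  + exact: (measurable_cVP _).1.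
  + by exists (c n).
  + by move=> m; exact: D0.
  rewrite big_ord_recr/= EFinD leeD//.
  have -> : (c n ^+ 2)%:E = (\int[P]_w (c n ^+ 2)%:E)%E.
    rewrite integral_cst//.
    by rewrite [X in (_ * X)%E](@probability_setT _ _ _ P) mule1.
  apply: ge0_le_integral => //.
  + by move=> w _; rewrite lee_fin sqr_ge0.
  + apply/measurable_EFinP; apply: measurable_funX.
    exact: (measurable_cVP _).1.
  + move=> w _; rewrite lee_fin -[leLHS]real_normK ?num_real// lerXn2r ?nnegrE//.
    exact: le_trans (Dc n w i).
have m1 : measurable_fun setT (fun s => F n (X s) - F 0%N (X0 s) - M s).
  apply: measurable_cVB => //; apply: measurable_cVB.
    exact: (measurableT_comp (mF n) pX.1).
  exact: (measurableT_comp (mF 0%N) pX0.1).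
have m2 : measurable_fun setT (fun z : S * O => F n z.2 - F n (X z.1)).
  apply: measurable_cVB; first exact: (measurableT_comp (mF n) msnd).
  exact: (measurableT_comp (measurableT_comp (mF n) pX.1) mfst).
have m3 : measurable_fun setT (fun w => F n.+1 w - F n w - D n w).
  by apply: measurable_cVB => //; exact: measurable_cVB.
(* The error splits into that of the old chain, that of the increment inside the new copy, and the
   jump of [F n] between two copies in the same cube. *)
rewrite (_ : (fun z => _) = fun z : S * O => (F n (X z.1) - F 0%N (X0 z.1) - M z.1) +
   ((F n.+1 z.2 - F n z.2 - D n z.2) + (F n z.2 - F n (X z.1)))); last first.
  by apply/funext => z /=; apply/matrixP => i j; rewrite !mxE; ring.
have m13 := measurableT_comp m1 mfst; have m33 := measurableT_comp m3 msnd.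
apply: (le_trans (LpNormD G p1 r1 m13 (measurable_cVD m33 m2))).
rewrite (LpNorm_preserves _ r1 Gfst m1).
rewrite big_ord_recr/= (_ : (n.+1%:R * (d%:R * a))%:E = ((n%:R * (d%:R * a))%:E + (d%:R * a)%:E)%E); last first.
  by rewrite -EFinD -natr1; congr EFin; ring.
rewrite addeACA leeD//.
apply: (le_trans (LpNormD G p1 r1 m33 m2)).
rewrite (LpNorm_preserves _ r1 Gsnd m3) leeD2l//.
apply: LpNorm_bound => //; first by rewrite mulr_ge0 ?ler0n// ltW.
(* Off this null set both copies lie in one cube, so the jump is at most [d * a]. *)
exists [set z | k z.1 != l z.2]; split => //.
  have mkl : measurable_fun setT (fun z : S * O => k z.1 == l z.2).
    apply: measurable_fun_eqn; first exact: (measurableT_comp mk mfst).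
    exact: (measurableT_comp ml msnd).
  rewrite (_ : [set z | _] = (fun z => k z.1 == l z.2) @^-1` [set false]); last first.
    by apply/seteqP; split => z /= => [/negbTE|/negbT].
  by rewrite -[X in measurable X]setTI; exact: mkl.
move=> z /=; apply: contra_notN => /eqP kz; exact: (cube_close r1 a0).
Qed.

End chain.

(** * Bounded vectors with small second moment are small in L^p *)

Section small_second_moment.
Context (R : realType) (d : nat) (p : R) (r : \bar R).
Hypotheses (p1 : 1 <= p) (r1 : (1 <= r)%E).

(** Each coordinate is split at the level [h]: below it the p-th power is at most [h ^ p], above it
    at most [B ^ p * (M / h) ^ 2]. The threshold [v] is uniform over all probability spaces, since
    the space of the chain changes with the mesh. *)
Lemma LpNorm_small (B e : R) : 0 <= B -> 0 < e -> exists2 v : R, 0 < v &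
  forall (dS : measure_display) (S : measurableType dS) (Q : probability S R)
    (M : S -> 'cV[R]_d), measurable_fun setT M ->
  (forall s i, `|M s i 0| <= B) ->
  (forall i, (\int[Q]_s (M s i 0 ^+ 2)%:E <= v%:E)%E) -> (LpNorm Q p r M <= e%:E)%E.
Proof.
move=> B0 e0.
have p0 : 0 < p by apply: lt_le_trans p1.
(* Each of the [d] coordinates will contribute at most [2 * h]; [d.+1] keeps the division meaningful
   for [d = 0]. *)
pose h := e / (2 * d.+1%:R).
have h0 : 0 < h by rewrite divr_gt0// mulr_gt0.
have hp0 : 0 < h `^ p by exact: powR_gt0.
have Bp0 : 0 <= B `^ p by exact: powR_ge0.
(* This makes the second part of the splitting at most [h ^ p]; the summand 1 guards against
   [B = 0]. *)
exists (h `^ p * h ^+ 2 / (B `^ p + 1)).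
  by rewrite divr_gt0 ?mulr_gt0 ?exprn_gt0//; lra.
move=> dS S Q M mM MB M2.
have mMi i : measurable_fun setT (fun s => M s i 0) by exact: (measurable_cVP _).1.
have mMe i : measurable_fun setT (fun s => M s i 0 *: (delta_mx i 0 : 'cV[R]_d)).
  by apply: measurable_cVZ => //; exact: measurable_cst.
rewrite (_ : M = fun s => \sum_i M s i 0 *: (delta_mx i 0 : 'cV[R]_d)); last first.
  apply/funext => s; apply/matrixP => i j; rewrite ord1 summxE (bigD1 i)//= big1 ?addr0.
    by rewrite !mxE !eqxx mulr1.
  by move=> u ui; rewrite !mxE eq_sym (negbTE ui) mulr0.
apply: (le_trans (LpNorm_sum Q p1 r1 _ mMe)).
apply: (@le_trans _ _ (\sum_(i < d) (2 * h)%:E)%E); last first.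
  rewrite sumEFin lee_fin sumr_const card_ord -[_ *+ d]mulr_natl /h.
  rewrite [leLHS](_ : _ = e * (d%:R / d.+1%:R)); last first.
    have : (d.+1%:R : R) != 0 by rewrite pnatr_eq0.
    by set n1 := d.+1%:R => n10; field.
  by rewrite ler_piMr ?(ltW e0)// ler_pdivrMr// mul1r ler_nat.
apply: lee_sum => i _; rewrite LpNormE.
rewrite (_ : (2 * h)%:E = (((2 * h) `^ p)%:E `^ p^-1)%E); last first.
  by rewrite poweR_EFin -powRrM mulfV ?gt_eqF// powRr1// mulr_ge0 ?ltW.
apply: le_poweR.
- by rewrite invr_ge0 ltW.
- by apply: integral_ge0 => s _; rewrite lee_fin powR_ge0.
apply: (@le_trans _ _ (\int[Q]_s ((h `^ p)%:E + (B `^ p / h ^+ 2)%:E * (M s i 0 ^+ 2)%:E))%E).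
  apply: ge0_le_integral => //.
  - by move=> s _; rewrite lee_fin powR_ge0.
  - exact: measurable_lrnorm_powR.
  - apply: emeasurable_funD => //; apply: emeasurable_funM => //.
    by apply/measurable_EFinP; apply: measurable_funX.
  move=> s _; rewrite -EFinM -EFinD lee_fin lrnormZ//.
  apply: (@le_trans _ _ (`|M s i 0| `^ p)).
    apply: ge0_ler_powR; rewrite ?nnegrE ?mulr_ge0 ?lrnorm_ge0 ?(ltW p0)//.
    by rewrite ler_piMr// lrnorm_delta.
  have [Mh|hM] := leP `|M s i 0| h.
    rewrite ler_wpDr//; first by apply: mulr_ge0; [rewrite divr_ge0 ?sqr_ge0|exact: sqr_ge0].
    by apply: ge0_ler_powR; rewrite ?nnegrE ?(ltW p0)// ltW.
  rewrite ler_wpDl ?powR_ge0//.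
  apply: (@le_trans _ _ (B `^ p * 1)).
    by rewrite mulr1; apply: ge0_ler_powR; rewrite ?nnegrE ?(ltW p0).
  rewrite -mulrA ler_wpM2l//.
  rewrite mulrC ler_pdivlMr ?exprn_gt0// mul1r.
  by rewrite -[leRHS]real_normK ?num_real// lerXn2r ?nnegrE ?(ltW h0)// ltW.
rewrite ge0_integralD//; last 3 first.
- by move=> s _; rewrite lee_fin ltW.
- by move=> s _; rewrite mule_ge0// lee_fin ?sqr_ge0// divr_ge0 ?sqr_ge0.
- apply: emeasurable_funM => //.
  by apply/measurable_EFinP; apply: measurable_funX.
rewrite integral_cst// [X in (_ * X + _)%E](@probability_setT _ _ _ Q) mule1.
rewrite ge0_integralZl//; last 3 first.
- by apply/measurable_EFinP; apply: measurable_funX.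
- by move=> s _; rewrite lee_fin sqr_ge0.
- by rewrite lee_fin divr_ge0 ?sqr_ge0.
apply: (@le_trans _ _ ((h `^ p)%:E + (B `^ p / h ^+ 2)%:E * (h `^ p * h ^+ 2 / (B `^ p + 1))%:E)%E).
  by rewrite leeD2l// lee_wpmul2l// lee_fin divr_ge0 ?sqr_ge0.
rewrite -EFinM -EFinD lee_fin.
have -> : B `^ p / h ^+ 2 * (h `^ p * h ^+ 2 / (B `^ p + 1)) = h `^ p * (B `^ p / (B `^ p + 1)).
  by field; rewrite gt_eqF//=; lra.
(* The total [2 * h ^ p] is at most [(2 * h) ^ p] because [p] is at least 1. *)
apply: (@le_trans _ _ (2 * h `^ p)).
  by rewrite mulr2n mulrDl mul1r lerD2l ler_piMr ?ltW// ltr_pdivrMr//; lra.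
rewrite (powRM p (ler0n R 2) (ltW h0)) ler_wpM2r ?(ltW hp0)//.
by rewrite -[leLHS](powRr1 (ler0n _ 2)) ler_powR// ler1n.
Qed.

End small_second_moment.

(** * Conditional expectation *)

Section cond_exp_existence.
Context (R : realType) (d : nat) (dO : measure_display) (O : measurableType dO)
  (P : probability O R).
Variables (X : O -> R) (F : O -> 'cV[R]_d).
Hypotheses (mF : measurable_fun setT F) (intX : P.-integrable setT (EFin \o X)).

Let F' : {mfun O >-> 'cV[R]_d} := HB.pack F (isMeasurableFun.Build _ _ _ _ F mF).

Let L : probability 'cV[R]_d R := distribution P F'.

Let nu : {charge set 'cV[R]_d -> \bar R} :=
  @measure_function_pushforward__canonical__charge_Charge _ _ _ _ F R (induced_charge intX) mF.

Let nu_dom : nu `<< L.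
Proof.
apply: dominates_pushforward => //.
apply/null_content_dominatesP => A mA PA; rewrite /induced_charge.
apply: null_set_integral => //; apply: measurable_funTS.
exact: measurable_int intX.
Qed.

(** The charge with density [X] is pushed forward by [F] to R^d and differentiated with respect to
    the law of [F]. Composing the derivative with [F] gives a version that is a function of [F]
    everywhere. *)
Lemma cond_exp_exists : exists Y, is_cond_exp P (sigma_of F) X Y.
Proof.
pose g := Radon_Nikodym nu L.
have gfin x : g x \is a fin_num by exact: Radon_Nikodym_fin_num.
have intg : L.-integrable setT g by exact: Radon_Nikodym_integrable.
have mg : measurable_fun setT (fine \o g).
  by apply: measurableT_comp => //; exact: measurable_int intg.
have gE : EFin \o (fine \o g) = g by apply/funext => x /=; rewrite fineK.
have mgF : measurable_fun setT (fun w => (fine (g (F w)))%:E).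
  by apply/measurable_EFinP; exact: (measurableT_comp mg mF).
have intgF : P.-integrable setT (EFin \o (fun w => fine (g (F w)))).
  apply/integrableP; split => //.
  have /integrableP[mg' goo] := intg.
  apply: le_lt_trans goo; rewrite le_eqVlt; apply/orP; left; apply/eqP.
  transitivity (\int[P]_w `|g (F w)|)%E.
    by apply: eq_integral => w _; rewrite /= -abse_EFin fineK.
  apply: (ge0_integral_preserves (P := L) (f := abse \o g)) => //.
    exact: measurableT_comp.
  by move=> w; exact: abse_ge0.
exists (fun w => fine (g (F w))); split => //.
- move=> B mB; exists ((fine \o g) @^-1` B); last by rewrite setTI.
  by rewrite -[X in measurable X]setTI; exact: mg.
- move=> _ [B mB <-]; rewrite setTI.
  transitivity (nu B); last by [].
  rewrite (Radon_Nikodym_integral nu_dom mB) -/g.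
  rewrite -[in RHS]gE (integral_pushforward (phi := F') (mu := P) mF)//.
  - by rewrite gE; exact: measurable_int intg.
  - by apply: integrableS intgF => //; rewrite -[X in measurable X]setTI; exact: mF.
Qed.

End cond_exp_existence.

Section cond_exp_theory.
Context (R : realType) (d : nat) (dO : measure_display) (O : measurableType dO)
  (P : probability O R).

Lemma cond_expP (X : O -> R) (F : O -> 'cV[R]_d) :
  measurable_fun setT F -> P.-integrable setT (EFin \o X) ->
  is_cond_exp P (sigma_of F) X (cond_exp P (sigma_of F) X).
Proof.
move=> mF intX; have [Y XY] := cond_exp_exists mF intX.
by rewrite /cond_exp; apply: (xgetPex (cst 0) (P := [set Y | is_cond_exp P (sigma_of F) X Y])); exists Y.
Qed.

(** Tower property and Jensen: the cells of [k \o F] belong to the sigma-algebra of [F], so [X] and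
    its conditional expectation have the same cell means. *)
Lemma LpNorm_cell_mean_cond_exp (p : R) (r : \bar R) (X F : O -> 'cV[R]_d)
    (k : 'cV[R]_d -> nat) : 1 <= p -> (1 <= r)%E ->
  measurable_fun setT F -> measurable_fun setT k -> integrable_vec P X ->
  (LpNorm P p r (cell_mean_vec P (k \o F) X) <= LpNorm P p r (cond_exp_vec P X F))%E.
Proof.
move=> p1 r1 mF mk iX.
have iY : integrable_vec P (cond_exp_vec P X F).
  move=> i; have [_ + _] := cond_expP mF (iX i).
  by apply: eq_integrable => // w _; rewrite /= mxE.
have mkF : measurable_fun setT (k \o F) by exact: measurableT_comp.
rewrite (@cell_mean_vec_eq _ _ _ P (k \o F) _ X (cond_exp_vec P X F)).
  exact: LpNorm_cell_mean.
move=> c i; have [_ _ XY] := cond_expP mF (iX i).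
rewrite /Rintegral; congr fine.
rewrite -XY; last first.
  exists (k @^-1` [set c]); first exact: measurable_cell.
  by rewrite setTI comp_preimage.
by apply: eq_integral => w _; rewrite mxE.
Qed.

End cond_exp_theory.

(** * Gaussian vectors and moments *)

Section integral_density.
Local Open Scope ereal_scope.
Context (R : realType) (dT : measure_display) (T : measurableType dT)
  (m nu : {measure set T -> \bar R}) (g : T -> \bar R).
Hypothesis gfin : forall x, g x \is a fin_num.
Hypotheses (mg : measurable_fun setT g) (g0 : forall x, 0 <= g x)
  (nuE : forall A, measurable A -> nu A = \int[m]_(x in A) g x).

Import HBNNSimple.

Let integral_density_nnsfun (h : {nnsfun T >-> R}) :
  \int[nu]_x (h x)%:E = \int[m]_x (g x * (h x)%:E).
Proof.
under [RHS]eq_integral.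
  move=> x _; rewrite fimfunE -fsumEFin// ge0_mule_fsumr; last first.
    by move=> r; rewrite EFinM nnfun_muleindic_ge0.
  over.
rewrite [RHS]ge0_integral_fsum//; last 2 first.
- move=> r; apply: emeasurable_funM => //; apply/measurable_EFinP.
  by do 2 apply/measurableT_comp => //.
- by move=> n x _; rewrite mule_ge0// EFinM nnfun_muleindic_ge0.
rewrite integralT_nnsfun sintegralE; apply: eq_fsbigr => r _.
have mr : measurable (h @^-1` [set r]) by exact: measurable_sfunP.
have [r0|r0] := leP 0%R r; last first.
  rewrite preimage_nnfun0// measure0 mule0; apply/esym/integral0_eq => x _.
  by rewrite indicE in_set0 mulr0 mule0.
transitivity (\int[m]_x (r%:E * (g x * (\1_(h @^-1` [set r]) x)%:E))); last first.
  by apply: eq_integral => x _; rewrite EFinM muleCA.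
rewrite ge0_integralZl//; last 2 first.
- by apply: emeasurable_funM => //; exact/measurable_EFinP.
- by move=> x _; rewrite mule_ge0.
rewrite nuE//; congr (_ * _).
by rewrite integral_mkcond; apply: eq_integral => x _; rewrite epatch_indic.
Qed.

(** From sets to simple functions by linearity, then to nonnegative functions by monotone
    convergence. *)
Lemma ge0_integral_density (f : T -> \bar R) : measurable_fun setT f -> (forall x, 0 <= f x) ->
  \int[nu]_x f x = \int[m]_x (g x * f x).
Proof.
move=> mf f0; pose f_ := nnsfun_approx measurableT mf.
have cf x : (f_ n x)%:E @[n --> \oo] --> f x by exact: cvg_nnsfun_approx.
have nd x : {homo (fun n => (f_ n x)%:E) : a b / (a <= b)%N >-> a <= b}.
  by move=> a b ab; rewrite lee_fin; exact/lefP/nd_nnsfun_approx.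
transitivity (limn (fun n => \int[nu]_x (f_ n x)%:E)).
  rewrite -monotone_convergence//.
  - by apply: eq_integral => x _; apply/esym/cvg_lim.
  - by move=> n; exact/measurable_EFinP.
  - by move=> n x _; rewrite lee_fin.
transitivity (limn (fun n => \int[m]_x (g x * (f_ n x)%:E))).
  by congr (limn _); apply/funext => n; exact: integral_density_nnsfun.
rewrite -monotone_convergence//.
- apply: eq_integral => x _; apply/cvg_lim => //.
  by apply: cvgeZl => //; exact: cf.
- by move=> n; apply: emeasurable_funM => //; exact/measurable_EFinP.
- by move=> n x _; rewrite mule_ge0// lee_fin.
- by move=> x _ a b ab; rewrite lee_wpmul2l//; exact: nd.
Qed.

End integral_density.

Section normal_moment.
Context (R : realType).

(** The inequality between [y] and [expR y] at [y = x ^ 2 / (2 * p)], raised to the power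
    [p / 2]. *)
Lemma powR_le_expR_sqr (p x : R) : 1 <= p ->
  `|x| `^ p <= (2 * p) `^ (p / 2) * expR (x ^+ 2 / 4).
Proof.
move=> p1; have p0 : 0 < p by lra.
pose q := p / 2; have q0 : 0 < q by rewrite /q; lra.
have -> : `|x| `^ p = (2 * p) `^ q * (x ^+ 2 / (2 * p)) `^ q.
  rewrite -powRM ?divr_ge0 ?sqr_ge0 ?mulr_ge0 ?(ltW p0)//.
  rewrite mulrCA mulfV ?mulr1 ?mulf_neq0 ?(gt_eqF p0)//.
  rewrite -[x ^+ 2]real_normK ?num_real// -powR_mulrn// -powRrM.
  by congr (_ `^ _); rewrite /q; field.
rewrite -/q ler_wpM2l ?powR_ge0//.
have -> : x ^+ 2 / 4 = (x ^+ 2 / (2 * p)) * q by rewrite /q; field; rewrite gt_eqF.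
rewrite expRM.
apply: ge0_ler_powR; rewrite ?nnegrE ?expR_ge0 ?divr_ge0 ?sqr_ge0 ?mulr_ge0 ?(ltW p0) ?(ltW q0)//.
by apply: le_trans (expR_ge1Dx _); rewrite lerDr.
Qed.

Lemma normal_moment (p : R) : 1 <= p ->
  (\int[normal_prob (0 : R) 1]_x (`|x| `^ p)%:E < +oo)%E.
Proof.
move=> p1.
have mpow : measurable_fun setT (fun x : R => (`|x| `^ p)%:E).
  apply/measurable_EFinP; apply: (measurableT_comp (measurable_powR _)).
  exact: normr_measurable.
have mpdf s : measurable_fun setT (fun x : R => (normal_pdf 0 s x)%:E).
  by apply/measurable_EFinP; exact: measurable_normal_pdf.
rewrite (@ge0_integral_density _ _ _ lebesgue_measure _ (fun x => (normal_pdf 0 1 x)%:E))//; last first.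
  by move=> x; rewrite lee_fin normal_pdf_ge0.
  exact: (mpdf 1).
(* The power of [x] costs half of the Gaussian exponent; what is left is the density of variance 2,
   up to the ratio of peaks contained in [C]. *)
pose s : R := Num.sqrt 2.
have s0 : s != 0 by rewrite gt_eqF// sqrtr_gt0.
pose C : R := (2 * p) `^ (p / 2) * normal_peak 1 / normal_peak s.
have C0 : 0 <= C by rewrite /C divr_ge0 ?mulr_ge0 ?powR_ge0 ?normal_peak_ge0.
apply: (@le_lt_trans _ _ (\int[lebesgue_measure]_x (C%:E * (normal_pdf 0 s x)%:E))%E).
  apply: ge0_le_integral => //.
  - by move=> x _; rewrite mule_ge0// lee_fin ?normal_pdf_ge0.
  - exact: (emeasurable_funM (mpdf 1) mpow).
  - exact: (emeasurable_funM (measurable_cst _) (mpdf s)).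
  - move=> x _; rewrite -!EFinM lee_fin.
    have e1 : normal_pdf 0 1 x = normal_peak 1 * expR (- (x ^+ 2 / 2)).
      rewrite normal_pdfE ?oner_neq0// /normal_fun subr0 expr1n mulNr.
      by [].
    have es : normal_pdf 0 s x = normal_peak s * expR (- (x ^+ 2 / 4)).
      rewrite normal_pdfE// /normal_fun subr0 sqr_sqrtr// mulNr.
      by rewrite -mulr_natr -natrM.
    have ps : normal_peak s != 0 by rewrite gt_eqF// normal_peak_gt0.
    rewrite e1 es /C (_ : _ / normal_peak s * _ =
      normal_peak 1 * ((2 * p) `^ (p / 2) * expR (- (x ^+ 2 / 4)))); last by field.
    rewrite -mulrA ler_wpM2l ?normal_peak_ge0//.
    apply: (le_trans (ler_wpM2l (expR_ge0 _) (powR_le_expR_sqr x p1))).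
    rewrite mulrCA -expRD ler_wpM2l ?powR_ge0// ler_expR.
    by rewrite le_eqVlt; apply/orP; left; apply/eqP; field.
rewrite ge0_integralZl//; last by move=> x _; rewrite lee_fin normal_pdf_ge0.
  by rewrite integral_normal_pdf mule1 ltry.
exact: (mpdf s).
Qed.

End normal_moment.

Section standard_gaussian.
Context (R : realType).

Definition std_gaussian_law d (g : set 'cV[R]_d -> \bar R) :=
  forall A : 'I_d -> set R, (forall i, measurable (A i)) ->
  g [set x | forall i, A i (x i 0)] = (\prod_(i < d) normal_prob 0 1 (A i))%E.

(** Induction on the dimension: the map [f] prepends an independent [N(0, 1)] coordinate. *)
Lemma exists_std_gaussian d : exists g : probability 'cV[R]_d R, std_gaussian_law g.
Proof.
elim: d => [|d [g gE]].
  exists (dirac (0 : 'cV[R]_0)) => A mA.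
  rewrite big_ord0 (_ : [set x | _] = setT); last by apply/seteqP; split => // x _ [].
  exact: probability_setT.
pose f (z : measurableTypeR R * 'cV[R]_d) : 'cV[R]_d.+1 := \col_i oapp (fun j => z.2 j 0) z.1 (unlift ord0 i).
have mf : measurable_fun setT f.
  apply/measurable_cVP => i; under eq_fun do rewrite mxE.
  case: (unlift ord0 i) => [j|] /=; last exact: measurable_fst.
  exact: (measurableT_comp (measurable_coord j) measurable_snd).
pose f' : {mfun (measurableTypeR R * 'cV[R]_d)%type >-> 'cV[R]_d.+1} := HB.pack f (isMeasurableFun.Build _ _ _ _ f mf).
pose N : probability (measurableTypeR R) R := normal_prob 0 1.
exists (distribution (N \x g)%E f') => A mA.
have fE : f @^-1` [set x | forall i, A i (x i 0)] =
    A ord0 `*` [set x : 'cV[R]_d | forall i, A (lift ord0 i) (x i 0)].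
  apply/seteqP; split => [[a x] /= h|[a x] /= [h0 h] i].
    split; first by have := h ord0; rewrite mxE unlift_none.
    by move=> i; have := h (lift ord0 i); rewrite mxE liftK.
  by rewrite mxE; case: unliftP => [j ->|->] /=.
rewrite -[LHS]/((N \x g)%E (f @^-1` [set x | forall i, A i (x i 0)])) fE.
rewrite product_measure1E//; last first.
  by apply: (measurable_box (A := fun i => A (lift ord0 i))) => i; exact: mA.
  exact: (mA ord0).
by rewrite big_ord_recl -(gE (fun i => A (lift ord0 i)) (fun i => mA _)).
Qed.

End standard_gaussian.

Section moments.
Context (R : realType) (d : nat) (dO : measure_display) (O : measurableType dO)
  (P : probability O R) (p : R) (r : \bar R).
Hypotheses (p1 : 1 <= p) (r1 : (1 <= r)%E).
Implicit Types X : O -> 'cV[R]_d.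

Let p0 : 0 < p. Proof. exact: lt_le_trans p1. Qed.

Lemma LpNorm_lty X : measurable_fun setT X ->
  (forall i, \int[P]_w (`|X w i 0| `^ p)%:E < +oo)%E -> (LpNorm P p r X < +oo)%E.
Proof.
move=> mX Xoo.
have mXi i : measurable_fun setT (fun w => X w i 0) by exact: (measurable_cVP _).1.
have mXe i : measurable_fun setT (fun w => X w i 0 *: (delta_mx i 0 : 'cV[R]_d)).
  by apply: measurable_cVZ => //; exact: measurable_cst.
rewrite (_ : X = fun w => \sum_i X w i 0 *: (delta_mx i 0 : 'cV[R]_d)); last first.
  apply/funext => w; apply/matrixP => i j; rewrite ord1 summxE (bigD1 i)//= big1 ?addr0.
    by rewrite !mxE !eqxx mulr1.
  by move=> u ui; rewrite !mxE eq_sym (negbTE ui) mulr0.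
apply: (le_lt_trans (LpNorm_sum P p1 r1 _ mXe)).
apply: lte_sum_pinfty => i _; rewrite LpNormE; apply: poweR_lty.
apply: le_lt_trans (Xoo i); apply: ge0_le_integral => //.
- by move=> w _; rewrite lee_fin powR_ge0.
- exact: measurable_lrnorm_powR.
- apply/measurable_EFinP; apply: (measurableT_comp (measurable_powR _)).
  exact: measurableT_comp.
- move=> w _; rewrite lee_fin lrnormZ//; apply: ge0_ler_powR.
  + exact: ltW.
  + by rewrite nnegrE mulr_ge0 ?lrnorm_ge0.
  + by rewrite nnegrE.
  + by rewrite ler_piMr// lrnorm_delta.
Qed.

Lemma integrable_vec_LpNorm X : measurable_fun setT X -> (LpNorm P p r X < +oo)%E ->
  integrable_vec P X.
Proof.
move=> mX LX i.
have mXi : measurable_fun setT (fun w => X w i 0) by exact: (measurable_cVP _).1.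
apply/integrableP; split; first exact/measurable_EFinP.
have mpow : measurable_fun setT (fun w => (`|X w i 0| `^ p)%:E).
  by apply/measurable_EFinP; apply: (measurableT_comp (measurable_powR _)); exact: measurableT_comp.
apply: (@le_lt_trans _ _ (\int[P]_w (1%:E + (`|X w i 0| `^ p)%:E))%E).
  apply: ge0_le_integral => //.
  - by do 2 apply: measurableT_comp => //.
  - exact: emeasurable_funD.
  - move=> w _; rewrite -EFinD lee_fin.
    have [X1|X1] := leP `|X w i 0| 1; first by rewrite ler_wpDr ?powR_ge0.
    by rewrite ler_wpDl// -[leLHS]powRr1// ler_powR// ltW.
rewrite ge0_integralD// integral_cst// [X in (_ * X + _)%E](@probability_setT _ _ _ P) mule1.
by rewrite lte_add_pinfty ?ltry//; exact: (LpNorm_coord p1 r1 i mX LX).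
Qed.

Lemma LpNorm_mulmx_lty (A : 'M[R]_d) X : measurable_fun setT X ->
  (LpNorm P p r X < +oo)%E -> (LpNorm P p r (fun w => A *m X w) < +oo)%E.
Proof.
move=> mX LX.
have mXi i : measurable_fun setT (fun w => X w i 0) by exact: (measurable_cVP _).1.
have mXe i : measurable_fun setT (fun w => X w i 0 *: col i A).
  by apply: measurable_cVZ => //; exact: measurable_cst.
rewrite (_ : (fun w => _) = fun w => \sum_i X w i 0 *: col i A); last first.
  apply/funext => w; apply/matrixP => i j; rewrite ord1 summxE mxE; apply: eq_bigr => u _.
  by rewrite !mxE mulrC.
apply: (le_lt_trans (LpNorm_sum P p1 r1 _ mXe)).
apply: lte_sum_pinfty => i _; apply: LpNorm_lty => // j.
have mpow u : measurable_fun setT (fun w => (`|X w u 0| `^ p)%:E).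
  by apply/measurable_EFinP; apply: (measurableT_comp (measurable_powR _)); exact: measurableT_comp.
under eq_integral do rewrite !mxE normrM powRM// EFinM muleC.
rewrite ge0_integralZl//.
apply: lte_mul_pinfty; rewrite ?lee_fin ?powR_ge0//.
exact: (LpNorm_coord p1 r1 i mX LX).
Qed.

End moments.

Section laws.
Context (R : realType) (d : nat) (dO : measure_display) (O : measurableType dO)
  (P : probability O R) (p : R) (r : \bar R).
Hypotheses (p1 : 1 <= p) (r1 : (1 <= r)%E).

(** [finite_moment] speaks of the [l^2] norm; the passage to [l^r] goes through the moments of
    single coordinates. *)
Lemma has_law_LpNorm_lty (mu : probability 'cV[R]_d R) (W : {RV P >-> 'cV[R]_d}) :
  finite_moment p mu -> has_law P W mu -> (LpNorm P p r W < +oo)%E.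
Proof.
move=> hmu hW; have mW : measurable_fun setT W by exact: measurable_funP.
have l12 : (1 <= 2%:E :> \bar R)%E by rewrite lee_fin ler1n.
have L2 : (LpNorm P p 2%:E W < +oo)%E.
  rewrite LpNormE; apply: poweR_lty.
  rewrite (ge0_integral_preserves (P := mu) (X := W)
    (f := fun x => (lrnorm 2%:E x `^ p)%:E))//.
  - by apply: measurable_lrnorm_powR; exact: measurable_id.
  - by move=> w; rewrite lee_fin powR_ge0.
apply: LpNorm_lty => // i.
exact: (LpNorm_coord p1 l12 i mW L2).
Qed.

Lemma std_gaussian_coord (Z : {RV P >-> 'cV[R]_d}) (i : 'I_d) : is_std_gaussian P Z ->
  preserves P (normal_prob (0 : R) 1) (fun w => Z w i 0).
Proof.
move=> hZ; split; first by apply: (measurable_cVP _).1; exact: measurable_funP.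
move=> A mA; pose B j := if j == i then A else setT.
have mB j : measurable (B j) by rewrite /B; case: ifP.
have := hZ B mB.
rewrite (bigD1 i)//= big1 ?mule1 => [|j /negbTE ji]; last first.
  by rewrite /B ji; exact: (@probability_setT _ _ _ (normal_prob 0 1)).
rewrite {2}/B eqxx => <-; congr (P _).
apply/seteqP; split => w /=; last by move=> /(_ i); rewrite /B eqxx.
by move=> Aw j; rewrite /B; case: eqP => // ->.
Qed.

Lemma std_gaussian_LpNorm_lty (Z : {RV P >-> 'cV[R]_d}) :
  is_std_gaussian P Z -> (LpNorm P p r Z < +oo)%E.
Proof.
move=> hZ; apply: LpNorm_lty => // i.
have := normal_moment p1.
have mpow : measurable_fun setT (fun x : R => (`|x| `^ p)%:E).
  apply/measurable_EFinP; apply: (measurableT_comp (measurable_powR _)).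
  exact: normr_measurable.
by rewrite -(ge0_integral_preserves (std_gaussian_coord i hZ) mpow).
Qed.

End laws.

(** * Dependence on the time parameter *)

(* The library states monotonicity for measurable integrands only; here [g] is arbitrary. *)
Lemma ge0_le_integral_nonmeasurable (R : realType) (dT : measure_display) (T : measurableType dT)
  (m : {measure set T -> \bar R}) (D : set T) (f g : T -> \bar R) :
  (forall x, D x -> 0 <= f x)%E -> (forall x, D x -> f x <= g x)%E ->
  (\int[m]_(x in D) f x <= \int[m]_(x in D) g x)%E.
Proof.
move=> f0 fg; have g0 x : D x -> (0 <= g x)%E by move=> Dx; rewrite (le_trans (f0 _ Dx))// fg.
rewrite !ge0_integralE//; apply: ereal_sup_le => /= _ [h hf <-].
exists h => //= x; apply: (le_trans (hf x)).
by rewrite !patchE; case: ifPn => //; rewrite inE => /fg.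
Qed.

Section parametric.
Context (R : realType) (dT dO : measure_display) (T : measurableType dT) (O : measurableType dO)
  (P : probability O R).

Lemma measurable_integral_param (h : T * O -> \bar R) : measurable_fun setT h ->
  measurable_fun setT (fun t => \int[P]_w h (t, w))%E.
Proof.
move=> mh.
rewrite (_ : (fun _ => _) = fun t => (\int[P]_w h^\+ (t, w) - \int[P]_w h^\- (t, w))%E); last first.
  by apply/funext => t; rewrite [LHS]integralE; congr (_ - _)%E; apply: eq_integral => w _; rewrite ?funeposE ?funenegE.
apply: emeasurable_funB.
- apply: (measurable_fun_fubini_tonelli_F (m2 := P) h^\+%E) => //.
  exact: measurable_funepos.
- apply: (measurable_fun_fubini_tonelli_F (m2 := P) h^\-%E) => //.
  exact: measurable_funeneg.
Qed.

Lemma measurable_inv_ge0 (f : T -> R) : measurable_fun setT f -> (forall x, 0 <= f x) ->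
  measurable_fun setT (fun x => (f x)^-1).
Proof.
move=> mf f0; under eq_fun do rewrite -powR_inv1//.
exact: (measurableT_comp (measurable_powR _) mf).
Qed.

End parametric.

Section parametric_cell_mean.
Context (R : realType) (dT dO : measure_display) (T : measurableType dT) (O : measurableType dO)
  (P : probability O R).
Variables (k : T * O -> nat).
Hypothesis mk : measurable_fun setT k.

(** The cell moves with the parameter and with the base point. Writing it as the condition that two
    labels agree turns the integral over the cell into one of a jointly measurable function over the
    whole space. *)
Lemma measurable_cell_integral_param (x : T * O -> R) : measurable_fun setT x ->
  measurable_fun setT (fun z : T * O =>
    \int[P]_(w in (fun w => k (z.1, w)) @^-1` [set k z]) x (z.1, w)).
Proof.
move=> mx.
pose h (y : (T * O) * O) : \bar R := if k (y.1.1, y.2) == k y.1 then (x (y.1.1, y.2))%:E else 0%E.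
have m1 : measurable_fun setT (fun y : (T * O) * O => (y.1.1, y.2)).
  apply: measurable_fun_pair => //.
  exact: (measurableT_comp measurable_fst measurable_fst).
have mh : measurable_fun setT h.
  apply: measurable_fun_ifT => //.
    apply: measurable_fun_eqn; first exact: (measurableT_comp mk m1).
    exact: (measurableT_comp mk measurable_fst).
  by apply/measurable_EFinP; exact: (measurableT_comp mx m1).
rewrite (_ : (fun _ => _) = fun z => fine (\int[P]_w h (z, w))%E); last first.
  apply/funext => z; rewrite /Rintegral; congr fine.
  rewrite integral_mkcond; apply: eq_integral => w _.
  rewrite patchE /h /=; case: ifPn => [|/negP] wz; case: ifPn => // /eqP wk.
    by exfalso; apply: wk; move: wz; rewrite inE.
  by exfalso; apply: wz; rewrite inE.
by apply: measurableT_comp => //; exact: measurable_integral_param.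
Qed.

Lemma measurable_cell_mean_param (x : T * O -> R) : measurable_fun setT x ->
  measurable_fun setT (fun z : T * O =>
    cell_mean P (fun w => k (z.1, w)) (fun w => x (z.1, w)) z.2).
Proof.
move=> mx.
have kz (z : T * O) : k (z.1, z.2) = k z by case: z.
(* The mass of the cell is written as the integral of 1, so that both factors fall under the
   previous lemma. *)
rewrite (_ : (fun _ => _) = fun z : T * O =>
    (\int[P]_(w in (fun w => k (z.1, w)) @^-1` [set k z]) x (z.1, w)) *
    (\int[P]_(w in (fun w => k (z.1, w)) @^-1` [set k z]) 1)^-1); last first.
  apply/funext => z; rewrite /cell_mean kz Rintegral_cst ?mul1r//.
  rewrite -[X in measurable X]setTI.
  by apply: (measurableT_comp mk (pair1_measurable _)) => //.
apply: measurable_funM; first exact: measurable_cell_integral_param.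
apply: measurable_inv_ge0; last by move=> z; exact: Rintegral_ge0.
exact: (measurable_cell_integral_param (x := fun=> 1)).
Qed.

Lemma measurable_LpNorm_param (d : nat) (p : R) (r : \bar R) (Y : T * O -> 'cV[R]_d) :
  measurable_fun setT Y -> measurable_fun setT (fun t => LpNorm P p r (fun w => Y (t, w))).
Proof.
move=> mY; under eq_fun do rewrite LpNormE.
apply: (measurableT_comp (measurable_poweR _)).
apply: (@measurable_integral_param _ _ _ _ _ P (fun z => (lrnorm r (Y z) `^ p)%:E)).
exact: measurable_lrnorm_powR.
Qed.

End parametric_cell_mean.

(** * Averaging Riemann sums over shifts of the grid *)

Section lebesgue_translation.
Context (R : realType).
Local Notation lambda := (@lebesgue_measure R).

Lemma lebesgue_measure_translation (c : R) :
  preserves lambda lambda ((fun x => c + x) : measurableTypeR R -> measurableTypeR R).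
Proof.
have mf : measurable_fun setT ((fun x => c + x) : measurableTypeR R -> measurableTypeR R).
  by apply: measurable_funD; [exact: measurable_cst|exact: measurable_id].
split => // A mA; apply/esym.
pose nu := @measure_function_pushforward__canonical__measure_function_Measure _ _ _ _ R lambda _ mf.
apply: (lebesgue_measure_unique (mu := nu)) => // _ [[a b]] _ <-.
rewrite /nu /= /pushforward.
rewrite (_ : _ @^-1` _ = `]a - c, b - c]%classic); last first.
  by apply/seteqP; split => x /=; rewrite !in_itv/= ltrBlDl lerBrDl.
rewrite !lebesgue_measure_itv/= !lte_fin ltrD2r; case: ifP => // _.
by rewrite -!EFinB; congr EFin; ring.
Qed.

Lemma ge0_integral_translation (m : R -> \bar R) (c h : R) :
  measurable_fun setT m -> (forall x, 0 <= m x)%E ->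
  (\int[lambda]_(x in `[0%R, h[) m (c + x)%R = \int[lambda]_(x in `[c, (c + h)%R[) m x)%E.
Proof.
move=> mm m0; have [mf lE] := lebesgue_measure_translation c.
pose nu := @measure_function_pushforward__canonical__measure_function_Measure _ _ _ _ R lambda _ mf.
transitivity (\int[nu]_(x in `[c, (c + h)%R[) m x)%E; last first.
  by apply: eq_measure_integral => A mA _; exact: lE.
rewrite ge0_integral_pushforward//; last exact: measurable_funTS.
congr (integral _ _ _); apply/seteqP; split => x /=; rewrite !in_itv/= lerDl ltrD2l//.
Qed.

(** For a merely measurable [m] a given Riemann sum may be far from the integral. Its mean over the
    shifts [u] in [[0, h)] is the integral over the union of the consecutive grid intervals, so not
    every shift can exceed the bound. *)
Lemma averaged_sum_le (m : R -> \bar R) (t0 h e : R) n : measurable_fun setT m ->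
  (forall x, 0 <= m x)%E -> 0 < t0 -> 0 < h -> 0 < e ->
  (\int[lambda]_(t in `]0%R, +oo[) m t < +oo)%E ->
  exists2 u, 0 <= u <= h & (\sum_(k < n) h%:E * m (t0 + k%:R * h + u)%R <=
    \int[lambda]_(t in `]0%R, +oo[) m t + e%:E)%E.
Proof.
move=> mm m0 t00 h0 e0 moo; set I := (\int[lambda]_(t in _) m t)%E in moo *.
have I0 : (0 <= I)%E by exact: integral_ge0.
apply: contrapT => H.
have {}H u : 0 <= u < h -> (I + e%:E <= \sum_(k < n) h%:E * m (t0 + k%:R * h + u)%R)%E.
  move=> /andP[u0 uh]; rewrite leNgt; apply/negP => /ltW Hu; apply: H; exists u => //.
  by rewrite u0 ltW.
have sumE N : (\sum_(k < N) \int[lambda]_(x in `[(t0 + k%:R * h)%R, (t0 + k%:R * h + h)%R[) m x =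
    \int[lambda]_(x in `[t0, (t0 + N%:R * h)%R[) m x)%E.
  elim: N => [|N ih].
    by rewrite big_ord0 mul0r addr0 set_itvco0 integral_set0.
  rewrite big_ord_recr/= ih -ge0_integral_setU//; last 2 first.
  - exact: measurable_funTS.
  - rewrite disj_set2E; apply/eqP/seteqP; split => x //=; rewrite !in_itv/=.
    by move=> [/andP[_ x1] /andP[]]; rewrite leNgt x1.
  congr (integral _ _ _); apply/seteqP; split => x /=; rewrite !in_itv/= -natr1 mulrDl mul1r addrA.
    case => /andP[x1 x2]; apply/andP; split => //; first by rewrite (lt_trans x2)// ltrDl.
    by rewrite (le_trans _ x1)// lerDl mulr_ge0// ltW.
  move=> /andP[x1 x2]; have [x3|x3] := ltP x (t0 + N%:R * h); [left|right]; apply/andP; split => //.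
have mt (c : R) : measurable_fun setT (fun x : R => m (c + x)).
  apply: (measurableT_comp mm).
  exact: (lebesgue_measure_translation c).1.
have : (I + e%:E <= I)%E.
  (* The lower bound assumed for all shifts is integrated against the uniform density [1 / h] on
     [[0, h)]. *)
  apply: (@le_trans _ _ (\int[lambda]_(u in `[0%R, h[) (h^-1%:E * (\sum_(k < n) h%:E * m (t0 + k%:R * h + u)%R)))%E).
    have -> : (I + e%:E = \int[lambda]_(u in `[0%R, h[) (h^-1%:E * (I + e%:E)))%E.
      rewrite integral_cst//= lebesgue_measure_itv/= lte_fin h0 oppr0 adde0.
      by rewrite muleAC -EFinM mulVf ?mul1e// gt_eqF.
    apply: ge0_le_integral => //.
    - by move=> u _; rewrite mule_ge0 ?lee_fin ?invr_ge0 ?(ltW h0)// adde_ge0// lee_fin ltW.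
    - apply: emeasurable_funM => //; apply: emeasurable_sum => k.
      by apply: emeasurable_funM => //; exact: (measurable_funTS (mt _)).
    - move=> u; rewrite /= in_itv/= => uh; rewrite lee_wpmul2l ?lee_fin ?invr_ge0 ?(ltW h0)//.
      exact: H.
  apply: (@le_trans _ _ (\sum_(k < n) \int[lambda]_(u in `[0%R, h[) m (t0 + k%:R * h + u)%R)%E).
    rewrite -ge0_integral_sum//; last by move=> k; exact: (measurable_funTS (mt _)).
    rewrite le_eqVlt; apply/orP; left; apply/eqP; apply: eq_integral => u _.
    rewrite ge0_sume_distrr; last by move=> k _; rewrite mule_ge0// lee_fin ltW.
    by apply: eq_bigr => k _; rewrite muleA -EFinM mulVf ?mul1e// gt_eqF.
  under eq_bigr do rewrite ge0_integral_translation//.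
  rewrite sumE; apply: ge0_subset_integral => //; first exact: measurable_funTS.
  by move=> x /=; rewrite !in_itv/= andbT => /andP[+ _]; exact: lt_le_trans.
by rewrite -{2}(adde0 I) leeD2lE ?ge0_fin_numE// lee_fin leNgt e0.
Qed.

End lebesgue_translation.

(** * Truncation *)

Section truncation.
Context (R : realType) (d : nat) (dO : measure_display) (O : measurableType dO)
  (P : probability O R) (p : R) (r : \bar R).
Hypotheses (p1 : 1 <= p) (r1 : (1 <= r)%E).

Definition trunc (L : R) (x : 'cV[R]_d) : 'cV[R]_d := if lrnorm r x <= L then x else 0.

Lemma measurable_trunc L : measurable_fun setT (trunc L).
Proof.
apply: measurable_fun_ifT; [|exact: measurable_id|exact: measurable_cst].
by apply: measurable_fun_ler; [exact: measurable_lrnorm|exact: measurable_cst].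
Qed.

Lemma trunc_coord L x i : 0 <= L -> `|trunc L x i 0| <= L.
Proof.
move=> L0; rewrite /trunc; case: ifP => [xL|_]; last by rewrite mxE normr0.
by rewrite (le_trans (le_coord_lrnorm r1 x i)).
Qed.

(** Dominated convergence along integer levels: at each point the truncation is eventually exact. *)
Lemma LpNorm_trunc (X : O -> 'cV[R]_d) (e : R) : measurable_fun setT X ->
  (LpNorm P p r X < +oo)%E -> 0 < e ->
  exists2 L, 0 <= L & (LpNorm P p r (fun w => X w - trunc L (X w))%R <= e%:E)%E.
Proof.
move=> mX LX e0; have p0 : 0 < p by exact: lt_le_trans p1.
pose f n w := (lrnorm r (X w - trunc n%:R (X w)) `^ p)%:E.
have mf n : measurable_fun setT (f n).
  apply: measurable_lrnorm_powR; apply: measurable_cVB => //.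
  exact: (measurableT_comp (measurable_trunc _) mX).
have fX w n : (`|f n w| <= (lrnorm r (X w) `^ p)%:E)%E.
  rewrite gee0_abs ?lee_fin ?powR_ge0//.
  apply: ge0_ler_powR; rewrite ?nnegrE ?lrnorm_ge0 ?(ltW p0)//.
  by rewrite /trunc; case: ifP => _; rewrite ?subrr ?subr0 ?lrnorm0 ?lrnorm_ge0.
have int0 : P.-integrable setT (fun w => (lrnorm r (X w) `^ p)%:E).
  apply/integrableP; split; first exact: measurable_lrnorm_powR.
  have -> : (\int[P]_x `|(lrnorm r (X x) `^ p)%:E| = LpNorm P p r X `^ p)%E.
    by rewrite LpNorm_powR//; apply: eq_integral => w _; rewrite gee0_abs// lee_fin powR_ge0.
  exact: poweR_lty.
have cv : {ae P, forall x, setT x -> f ^~ x @ \oo --> (cst 0%E) x}.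
  apply: aeW => w _; apply: cvg_near_cst; near=> n.
  rewrite /f /trunc ifT ?subrr ?lrnorm0 ?powR0// ?gt_eqF//.
  by near: n; exact: nbhs_infty_ger.
have [_ _] := dominated_convergence measurableT mf (measurable_cst _) cv int0 (aeW P (fun w n _ => fX w n)).
have -> : (\int[P]_x cst 0 x = 0)%E by exact: integral0.
move=> /(_ [set x | x < (e `^ p)%:E]%E) [].
  by apply: open_nbhs_nbhs; split; [exact: open_ereal_lt_ereal|rewrite /= lte_fin powR_gt0].
move=> n _ /(_ n (leqnn _)) /= fn; exists n%:R => //.
rewrite LpNormE (_ : e%:E = ((e `^ p)%:E `^ p^-1)%E); last first.
  by rewrite poweR_EFin -powRrM mulfV ?gt_eqF// powRr1// ltW.
apply: le_poweR; last exact: ltW.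
- by rewrite invr_ge0 ltW.
- by apply: integral_ge0 => w _; rewrite lee_fin powR_ge0.
Unshelve. all: by end_near. Qed.

End truncation.

(** * One step along the Ornstein-Uhlenbeck path *)

Section ou_coefficients.
Context (R : realType).
Implicit Types s t h : R.

Definition ou_b t : R := Num.sqrt (1 - expR (- (2 * t))).
(** The derivative of [ou_b], in the form that the velocity produces: the factor [expR (- t)] times
    the coefficient of [G]. *)
Definition ou_db t : R := expR (- t) * (Num.sqrt (expR (2 * t) - 1))^-1.

(** The second-order remainder is bounded by [h] times a difference rather than by [h ^ 2], so that
    it telescopes along the grid. *)
Lemma ou_a_tangent t h : 0 <= h ->
  0 <= expR (- (t + h)) - expR (- t) + h * expR (- t) <=
  h * (expR (- t) - expR (- (t + h))).
Proof.
move=> h0; have e0 := expR_gt0 (- t); have e1 := expR_gt0 (- (t + h)).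
have h1 : expR (- t) * (1 - h) <= expR (- (t + h)).
  by rewrite opprD expRD ler_wpM2l// expR_ge1Dx.
have h2 : expR (- (t + h)) * (1 + h) <= expR (- t).
  have -> : expR (- t) = expR (- (t + h)) * expR h by rewrite -expRD; congr expR; ring.
  by rewrite ler_wpM2l ?(ltW e1)// expR_ge1Dx.
by apply/andP; split; lra.
Qed.

Lemma ou_b_sqr t : 0 <= t -> ou_b t ^+ 2 = 1 - expR (- (2 * t)).
Proof.
move=> t0; have : expR (- (2 * t)) <= 1 by rewrite -[leRHS]expR0 ler_expR; lra.
by move=> e1; rewrite sqr_sqrtr// subr_ge0.
Qed.

Lemma ou_b_gt0 t : 0 < t -> 0 < ou_b t.
Proof.
move=> t0; have : expR (- (2 * t)) < 1 by rewrite -[ltRHS]expR0 ltr_expR; lra.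
by move=> e1; rewrite sqrtr_gt0 subr_gt0.
Qed.

Lemma ou_b_le1 t : ou_b t <= 1.
Proof.
by rewrite -[leRHS]sqrtr1 ler_wsqrtr// lerBlDr lerDl expR_ge0.
Qed.

Lemma ou_dbE t : 0 < t -> ou_db t = expR (- (2 * t)) / ou_b t.
Proof.
move=> t0; rewrite /ou_db.
have -> : expR (2 * t) - 1 = expR t ^+ 2 * (1 - expR (- (2 * t))).
  by rewrite mulrBr mulr1 -!expRM_natl -expRD subrr expR0.
rewrite sqrtrM ?sqr_ge0// sqrtr_sqr ger0_norm ?expR_ge0// -/(ou_b t).
rewrite invfM mulrA -expRN -expRD; congr (expR _ / _); ring.
Qed.

Lemma ou_db_ge0 t : 0 <= ou_db t.
Proof. by rewrite /ou_db mulr_ge0 ?expR_ge0// invr_ge0. Qed.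

(** Concavity of [ou_b]. Convexity of the exponential gives the tangent bound for the square of
    [ou_b], and the square of [ou_b s - ou_b t] being nonnegative transfers it to [ou_b]. *)
Lemma ou_b_tangent s t : 0 < s -> 0 < t -> ou_b s <= ou_b t + (s - t) * ou_db t.
Proof.
move=> s0 t0; have bs := ou_b_gt0 s0; have bt := ou_b_gt0 t0.
rewrite ou_dbE// -(ler_pM2r bt) mulrDl mulrA divfK ?gt_eqF//.
have hs := ou_b_sqr (ltW s0); have ht := ou_b_sqr (ltW t0).
have e0 := expR_gt0 (- (2 * t)).
have : expR (- (2 * t)) * (1 - 2 * (s - t)) <= expR (- (2 * s)).
  have -> : expR (- (2 * s)) = expR (- (2 * t)) * expR (- (2 * (s - t))).
    by rewrite -expRD; congr expR; ring.
  by rewrite ler_wpM2l ?(ltW e0)// expR_ge1Dx.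
have : 0 <= (ou_b s - ou_b t) ^+ 2 by exact: sqr_ge0.
by rewrite !expr2 in hs ht *; nra.
Qed.

(** Add the tangent inequalities at [s] and at [t]. *)
Lemma ou_db_antitone s t : 0 < s -> s <= t -> ou_db t <= ou_db s.
Proof.
move=> s0; rewrite le_eqVlt => /predU1P[->//|st]; have t0 := lt_trans s0 st.
have h1 := ou_b_tangent s0 t0; have h2 := ou_b_tangent t0 s0.
have : 0 <= (t - s) * (ou_db s - ou_db t) by nra.
by rewrite pmulr_rge0 ?subr_gt0// subr_ge0.
Qed.

Lemma ou_b_monotone s t : 0 < s -> s <= t -> ou_b s <= ou_b t.
Proof.
move=> s0 st; have := ou_b_tangent s0 (lt_le_trans s0 st).
move=> /le_trans; apply; have := ou_db_ge0 t; nra.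
Qed.

Lemma ou_b_small t : 0 <= t -> ou_b t <= Num.sqrt (2 * t).
Proof.
by move=> t0; rewrite ler_wsqrtr// lerBlDr -lerBlDl expR_ge1Dx.
Qed.

Lemma ou_b_large t : 0 < t -> 1 - ou_b t <= expR (- t).
Proof.
move=> t0; have b0 := ou_b_gt0 t0; have b1 := ou_b_le1 t; have b2 := ou_b_sqr (ltW t0).
have e1 : expR (- t) <= 1 by rewrite -expR0 ler_expR; lra.
have e0 := expR_gt0 (- t).
have eE : expR (- (2 * t)) = expR (- t) * expR (- t) by rewrite -expRD; congr expR; ring.
by rewrite expr2 eE in b2; nra.
Qed.

Lemma ou_a_large t : 0 < t -> expR (- t) <= t^-1.
Proof.
move=> t0; rewrite expRN lef_pV2 ?posrE ?expR_gt0//.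
by apply: le_trans (expR_ge1Dx t); rewrite lerDr.
Qed.

End ou_coefficients.

Section integrable_vec_theory.
Context (R : realType) (d : nat) (dO : measure_display) (O : measurableType dO)
  (P : probability O R).
Implicit Types X Y : O -> 'cV[R]_d.

Lemma integrable_vecD X Y : integrable_vec P X -> integrable_vec P Y ->
  integrable_vec P (fun w => X w + Y w).
Proof.
move=> iX iY i; have := integrableD measurableT (iX i) (iY i).
by apply: eq_integrable => // w _; rewrite mxE EFinD.
Qed.

Lemma integrable_vecZ (a : R) X : integrable_vec P X -> integrable_vec P (fun w => a *: X w).
Proof.
move=> iX i; have := integrableZl measurableT a (iX i).
by apply: eq_integrable => // w _; rewrite mxE EFinM.
Qed.

End integrable_vec_theory.

Section ou_step.
Context (R : realType) (d : nat) (dO : measure_display) (O : measurableType dO)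
  (P : probability O R) (p : R) (r : \bar R).
Hypotheses (p1 : 1 <= p) (r1 : (1 <= r)%E).
Variables (W G : O -> 'cV[R]_d).
Hypotheses (mW : measurable_fun setT W) (mG : measurable_fun setT G).
Variables (A B : R).
Hypotheses (WA : LpNorm P p r W = A%:E) (GB : LpNorm P p r G = B%:E).

Definition ou_path t w : 'cV[R]_d := expR (- t) *: W w + ou_b t *: G w.
(* The derivative of [ou_path] at [t] is [- expR (- t) *: ou_velocity t]. *)
Definition ou_velocity t w : 'cV[R]_d := W w - (Num.sqrt (expR (2 * t) - 1))^-1 *: G w.

Variables (cell : 'cV[R]_d -> nat).
Hypothesis mcell : measurable_fun setT cell.

(** The discrete counterpart of rho_t: a cell mean in place of the conditional expectation given the
    path at time [t]. *)
Definition cell_drift t w : 'cV[R]_d :=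
  expR (- t) *: cell_mean_vec P (cell \o ou_path t) (ou_velocity t) w.

Let A0 : 0 <= A. Proof. by rewrite -lee_fin -WA LpNorm_ge0. Qed.
Let B0 : 0 <= B. Proof. by rewrite -lee_fin -GB LpNorm_ge0. Qed.

Lemma measurable_ou_path t : measurable_fun setT (ou_path t).
Proof. by apply: measurable_cVD; apply: measurable_cVZ => //; exact: measurable_cst. Qed.

Lemma measurable_ou_velocity t : measurable_fun setT (ou_velocity t).
Proof. by apply: measurable_cVB => //; apply: measurable_cVZ => //; exact: measurable_cst. Qed.

Lemma LpNorm_lin a b : (LpNorm P p r (fun w => (a *: W w + b *: G w)%R) <=
  (`|a| * A + `|b| * B)%:E)%E.
Proof.
have mZ c (X : O -> 'cV[R]_d) : measurable_fun setT X -> measurable_fun setT (fun w => c *: X w).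
  by move=> mX; apply: measurable_cVZ => //; exact: measurable_cst.
apply: (le_trans (LpNormD P p1 r1 (mZ a _ mW) (mZ b _ mG))).
by rewrite !LpNormZ// WA GB EFinD !EFinM.
Qed.

Let iW : integrable_vec P W.
Proof. by apply: (integrable_vec_LpNorm p1 r1 mW); rewrite WA ltry. Qed.

Let iG : integrable_vec P G.
Proof. by apply: (integrable_vec_LpNorm p1 r1 mG); rewrite GB ltry. Qed.

Variables (LW LG : R) (e : R).
Hypotheses (LW0 : 0 <= LW) (LG0 : 0 <= LG).
Hypothesis We : (LpNorm P p r (fun w => W w - trunc r LW (W w))%R <= e%:E)%E.
Hypothesis Ge : (LpNorm P p r (fun w => G w - trunc r LG (G w))%R <= e%:E)%E.

(** Truncating [W] and [G], and not the increment, keeps the bound proportional to the increments of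
    the two coefficients, which have total variation at most 1 each along the grid. *)
Definition trunc_incr t h w : 'cV[R]_d :=
  (expR (- (t + h)) - expR (- t)) *: trunc r LW (W w) + (ou_b (t + h) - ou_b t) *: trunc r LG (G w).

Definition centered_incr t h w : 'cV[R]_d :=
  trunc_incr t h w - cell_mean_vec P (cell \o ou_path t) (trunc_incr t h) w.

Let mcp t : measurable_fun setT (cell \o ou_path t).
Proof. by apply: measurableT_comp => //; exact: measurable_ou_path. Qed.

Lemma measurable_trunc_incr t h : measurable_fun setT (trunc_incr t h).
Proof.
apply: measurable_cVD; apply: measurable_cVZ; try exact: measurable_cst.
  exact: (measurableT_comp (measurable_trunc _ _) mW).
exact: (measurableT_comp (measurable_trunc _ _) mG).
Qed.

Lemma measurable_centered_incr t h : measurable_fun setT (centered_incr t h).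
Proof.
apply: measurable_cVB; first exact: measurable_trunc_incr.
exact: measurable_cell_mean_vec.
Qed.

Lemma trunc_incr_bound t h w i : `|trunc_incr t h w i 0| <=
  (LW + LG) * (`|expR (- (t + h)) - expR (- t)| + `|ou_b (t + h) - ou_b t|).
Proof.
rewrite !mxE; apply: (le_trans (ler_normD _ _)); rewrite !normrM.
have hw := trunc_coord r1 (W w) i LW0; have hg := trunc_coord r1 (G w) i LG0.
rewrite mulrDr lerD//.
  by rewrite mulrC ler_wpM2r// (le_trans hw)// lerDl.
by rewrite mulrC ler_wpM2r// (le_trans hg)// lerDr.
Qed.

Let coord_measurable t h i : measurable_fun setT (fun w => trunc_incr t h w i 0).
Proof. exact: (measurable_cVP _).1 (measurable_trunc_incr t h) i. Qed.

Lemma centered_incr_bound t h w i : `|centered_incr t h w i 0| <=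
  2 * ((LW + LG) * (`|expR (- (t + h)) - expR (- t)| + `|ou_b (t + h) - ou_b t|)).
Proof.
have B2 (x : R) : 2 * x = x + x by ring.
rewrite B2 [X in `|X| <= _]mxE [X in `|_ + X| <= _]mxE; apply: (le_trans (ler_normB _ _)).
rewrite lerD//; first exact: trunc_incr_bound.
rewrite mxE; apply: cell_mean_bound => //.
by move=> w'; exact: trunc_incr_bound.
Qed.

Let trunc_incr_int t h : integrable_vec P (trunc_incr t h).
Proof.
move=> i; apply: (@le_integrable _ _ _ _ _ _ _ (EFin \o cst
  ((LW + LG) * (`|expR (- (t + h)) - expR (- t)| + `|ou_b (t + h) - ou_b t|)))) => //.
- exact/measurable_EFinP.
- by move=> w _; rewrite /= lee_fin (le_trans (trunc_incr_bound _ _ _ _))// ler_norm.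
- exact: finite_measure_integrable_cst.
Qed.

Lemma centered_incr_mean t h c i :
  \int[P]_(w in (fun w => cell (ou_path t w)) @^-1` [set c]) (centered_incr t h w i 0) = 0.
Proof.
have mc := measurable_cell (mcp t) c.
under eq_Rintegral do rewrite mxE [X in _ + X]mxE [X in _ - X]mxE.
have ii := trunc_incr_int t h i.
rewrite RintegralB//; last 2 first.
- exact: integrableS ii.
- apply: integrableS (integrable_cell_mean P (mcp t) (coord_measurable t h i) _) => //.
  by eexists => w; exact: trunc_incr_bound.
by rewrite (cell_mean_int (mcp t) c ii) subrr.
Qed.

(* Up to second order in [h] and the truncation error, the increment of the path minus its cell mean
   is [centered_incr]; what remains is the cell mean of [- h *: expR (- t) *: ou_velocity t]. *)
Lemma ou_step t h : 0 < t -> 0 <= h ->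
  (LpNorm P p r (fun w => ou_path (t + h) w - ou_path t w - centered_incr t h w)%R <=
   h%:E * LpNorm P p r (cell_drift t) +
   (h * (expR (- t) - expR (- (t + h))) * A + h * (ou_db t - ou_db (t + h)) * B +
    2 * ((`|expR (- (t + h)) - expR (- t)| + `|ou_b (t + h) - ou_b t|) * e))%:E)%E.
Proof.
move=> t0 h0.
set al := expR (- (t + h)) - expR (- t); set be := ou_b (t + h) - ou_b t.
set a := expR (- t); set c := (Num.sqrt (expR (2 * t) - 1))^-1.
(* [Z] is the second-order remainder of the path and [Y] the truncation error of its increment. *)
pose Z w : 'cV[R]_d := (al + h * a) *: W w + (be - h * ou_db t) *: G w.
pose Y w : 'cV[R]_d := al *: (W w - trunc r LW (W w)) + be *: (G w - trunc r LG (G w)).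
pose V := ou_velocity t.
have mZc k (X : O -> 'cV[R]_d) : measurable_fun setT X -> measurable_fun setT (fun w => k *: X w).
  by move=> mX; apply: measurable_cVZ => //; exact: measurable_cst.
have mZ : measurable_fun setT Z by apply: measurable_cVD; exact: mZc.
have mtW : measurable_fun setT (fun w => W w - trunc r LW (W w)).
  by apply: measurable_cVB => //; exact: (measurableT_comp (measurable_trunc _ _) mW).
have mtG : measurable_fun setT (fun w => G w - trunc r LG (G w)).
  by apply: measurable_cVB => //; exact: (measurableT_comp (measurable_trunc _ _) mG).
have mY : measurable_fun setT Y by apply: measurable_cVD; exact: mZc.
have mV : measurable_fun setT V by exact: measurable_ou_velocity.
have Zle : (LpNorm P p r Z <= (h * (a - expR (- (t + h))) * A + h * (ou_db t - ou_db (t + h)) * B)%:E)%E.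
  apply: (le_trans (LpNorm_lin _ _)); rewrite lee_fin lerD// ler_wpM2r//.
    have /andP[h1 h2] := ou_a_tangent t h0.
    by rewrite ger0_norm.
  have th0 : 0 < t + h by rewrite ltr_wpDr.
  have h1 := ou_b_tangent th0 t0; have h2 := ou_b_tangent t0 th0.
  rewrite ler_norml; apply/andP; split; rewrite /be; lra.
have Yle : (LpNorm P p r Y <= ((`|al| + `|be|) * e)%:E)%E.
  apply: (le_trans (LpNormD P p1 r1 (mZc al _ mtW) (mZc be _ mtG))).
  by rewrite !LpNormZ// mulrDl EFinD !EFinM leeD// lee_wpmul2l.
have Yoo : (LpNorm P p r Y < +oo)%E by rewrite (le_lt_trans Yle)// ltry.
have iY := integrable_vec_LpNorm p1 r1 mY Yoo.
have iV : integrable_vec P V.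
  have := integrable_vecD iW (integrable_vecZ (- c) iG).
  by rewrite (_ : (fun w => _) = V)//; apply/funext => w; rewrite scaleNr.
have iZ : integrable_vec P Z by apply: integrable_vecD; exact: integrable_vecZ.
have TE : trunc_incr t h = fun w => (- (h * a)) *: V w + (Z w + (-1) *: Y w).
  apply/funext => w; apply/matrixP => i j; rewrite !mxE -/al -/be /ou_db -/a -/c; ring.
have ME : cell_mean_vec P (cell \o ou_path t) (trunc_incr t h) = fun w =>
    (- (h * a)) *: cell_mean_vec P (cell \o ou_path t) V w +
    (cell_mean_vec P (cell \o ou_path t) Z w + (-1) *: cell_mean_vec P (cell \o ou_path t) Y w).
  rewrite TE cell_mean_vecD//; last 2 first.
  - exact: integrable_vecZ.
  - by apply: integrable_vecD => //; exact: integrable_vecZ.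
  rewrite cell_mean_vecZ// cell_mean_vecD//; last exact: integrable_vecZ.
  by rewrite cell_mean_vecZ.
have mM X : measurable_fun setT (cell_mean_vec P (cell \o ou_path t) (X : O -> 'cV[R]_d)).
  exact: measurable_cell_mean_vec.
(* The increment minus [trunc_incr] is [Y], and the cell mean of [trunc_incr] adds the drift, the
   mean of [Z] and minus the mean of [Y]. So the truncation error is counted twice. *)
have -> : (fun w => ou_path (t + h) w - ou_path t w - centered_incr t h w) = fun w =>
    (- h) *: cell_drift t w + (cell_mean_vec P (cell \o ou_path t) Z w +
    (Y w + (-1) *: cell_mean_vec P (cell \o ou_path t) Y w)).
  apply/funext => w; rewrite /centered_incr ME /cell_drift -/a -/V.
  move: (cell_mean_vec P (cell \o ou_path t) V w) (cell_mean_vec P (cell \o ou_path t) Z w)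
    (cell_mean_vec P (cell \o ou_path t) Y w) => x y z.
  rewrite /trunc_incr /ou_path -/al -/be /Y.
  apply/matrixP => i j; rewrite !mxE /al /be /a; ring.
have md : measurable_fun setT (cell_drift t) by exact: mZc.
have m1 := mZc (- h) _ md.
have m2 := mZc (-1) _ (mM Y).
have m3 := measurable_cVD mY m2.
have m4 := measurable_cVD (mM Z) m3.
apply: (le_trans (LpNormD P p1 r1 m1 m4)).
rewrite LpNormZ// normrN (ger0_norm h0) leeD2l//.
apply: (le_trans (LpNormD P p1 r1 (mM Z) m3)); rewrite EFinD leeD//.
  by apply: le_trans Zle; exact: LpNorm_cell_mean.
have B2 (x : R) : 2 * x = x + x by ring.
apply: (le_trans (LpNormD P p1 r1 mY m2)); rewrite B2 EFinD leeD//.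
rewrite LpNormZ// normrN1 mul1e.
by apply: le_trans Yle; exact: LpNorm_cell_mean.
Qed.

End ou_step.

(** * The Ornstein-Uhlenbeck chain *)

Lemma big_ord_ends (V : nmodType) (f : nat -> V) n :
  \sum_(k < n.+2) f k = f 0%N + \sum_(k < n) f k.+1 + f n.+1.
Proof. by rewrite big_ord_recl big_ord_recr/= addrA. Qed.

Lemma exists_small (R : realFieldType) (K e : R) : 0 <= K -> 0 < e ->
  exists2 y : R, 0 < y <= 1 & y * K <= e.
Proof.
move=> K0 e0; have Ke : 0 < K + e by rewrite ltr_wpDl.
exists (e / (K + e)).
  by rewrite divr_gt0//= ler_pdivrMr// mul1r lerDr.
by rewrite mulrAC ler_pdivrMr//; nra.
Qed.

Section ou_chain.
Context (R : realType) (d : nat) (dO : measure_display) (O : measurableType dO)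
  (P : probability O R) (p : R) (r : \bar R).
Hypotheses (p1 : 1 <= p) (r1 : (1 <= r)%E).
Variables (W G : O -> 'cV[R]_d).
Hypotheses (mW : measurable_fun setT W) (mG : measurable_fun setT G).
Variables (A B : R).
Hypotheses (WA : LpNorm P p r W = A%:E) (GB : LpNorm P p r G = B%:E).

Let A0 : 0 <= A. Proof. by rewrite -lee_fin -WA LpNorm_ge0. Qed.
Let B0 : 0 <= B. Proof. by rewrite -lee_fin -GB LpNorm_ge0. Qed.

Let iW : integrable_vec P W.
Proof. by apply: (integrable_vec_LpNorm p1 r1 mW); rewrite WA ltry. Qed.

Let iG : integrable_vec P G.
Proof. by apply: (integrable_vec_LpNorm p1 r1 mG); rewrite GB ltry. Qed.

(* [rho P Sigma W Z2 t] of the statement, with [G] in place of [sqrtmx Sigma *m Z2]. *)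
Definition ou_score t : O -> 'cV[R]_d := fun w =>
  expR (- t) *: cond_exp_vec P (ou_velocity W G t) (ou_path W G t) w.

Lemma integrable_ou_velocity t : integrable_vec P (ou_velocity W G t).
Proof.
have := integrable_vecD iW (integrable_vecZ (- (Num.sqrt (expR (2 * t) - 1))^-1) iG).
by rewrite (_ : (fun w => _) = ou_velocity W G t)//; apply/funext => w; rewrite scaleNr.
Qed.

Lemma cell_drift_le_score cell t : measurable_fun setT cell ->
  (LpNorm P p r (cell_drift P W G cell t) <= LpNorm P p r (ou_score t))%E.
Proof.
move=> mc; have mp := measurable_ou_path mW mG t; have iv := integrable_ou_velocity t.
rewrite /cell_drift /ou_score !LpNormZ//.
- by rewrite lee_wpmul2l// LpNorm_cell_mean_cond_exp.
- apply/measurable_cVP => i; under eq_fun do rewrite mxE.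
  have [_ /measurable_int/measurable_EFinP + _] := cond_expP mp (iv i); exact.
- by apply: measurable_cell_mean_vec; exact: measurableT_comp.
Qed.

(** The reason to work with [cell_drift]: unlike [ou_score], it is an explicit jointly measurable
    function of time and sample point. *)
Lemma measurable_cell_drift_norm cell : measurable_fun setT cell ->
  measurable_fun setT (fun t : R => LpNorm P p r (cell_drift P W G cell t)).
Proof.
move=> mc.
have mt (f : R -> R) : measurable_fun setT f ->
    measurable_fun setT (fun z : measurableTypeR R * O => f z.1).
  by move=> mf; exact: (measurableT_comp mf measurable_fst).
have mw (X : O -> 'cV[R]_d) : measurable_fun setT X ->
    measurable_fun setT (fun z : measurableTypeR R * O => X z.2).
  by move=> mX; exact: (measurableT_comp mX measurable_snd).
have me (c : R) : measurable_fun setT (fun t : R => expR (c * t)).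
  by apply: (measurableT_comp (@measurable_expR R)); exact: measurable_funM.
have me1 : measurable_fun setT (fun t : R => expR (- t)).
  by under eq_fun do rewrite -mulN1r; exact: me.
have msqrt : measurable_fun setT (@Num.sqrt R) by exact: continuous_measurable_fun (@sqrt_continuous R).
have mb : measurable_fun setT (@ou_b R).
  apply: (measurableT_comp msqrt); apply: measurable_funB => //.
  by under eq_fun do rewrite -mulNr; exact: me.
have mc1 : measurable_fun setT (fun t : R => (Num.sqrt (expR (2 * t) - 1))^-1).
  apply: measurable_inv_ge0 => //; apply: (measurableT_comp msqrt).
  by apply: measurable_funB => //; exact: me.
have mF : measurable_fun setT (fun z : measurableTypeR R * O => ou_path W G z.1 z.2).
  apply: measurable_cVD; apply: measurable_cVZ.
  - exact: mt me1.
  - exact: mw.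
  - exact: mt mb.
  - exact: mw.
have mV : measurable_fun setT (fun z : measurableTypeR R * O => ou_velocity W G z.1 z.2).
  by apply: measurable_cVB; [exact: mw|apply: measurable_cVZ; [exact: mt mc1|exact: mw]].
have mk := measurableT_comp mc mF.
apply: (@measurable_LpNorm_param _ _ _ (measurableTypeR R) O P d p r
  (fun z => cell_drift P W G cell z.1 z.2)).
apply: measurable_cVZ; first exact: mt me1.
apply/measurable_cVP => i; under eq_fun do rewrite mxE.
exact: (measurable_cell_mean_param P mk ((measurable_cVP _).1 mV i)).
Qed.

Variables (LW LG e : R).
Hypotheses (LW0 : 0 <= LW) (LG0 : 0 <= LG) (e0 : 0 <= e).
Hypothesis We : (LpNorm P p r (fun w => W w - trunc r LW (W w))%R <= e%:E)%E.
Hypothesis Ge : (LpNorm P p r (fun w => G w - trunc r LG (G w))%R <= e%:E)%E.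

(** The path is followed only from [tau > 0] to [tau + n * h], because [ou_db] is unbounded near 0.
    One extra step at each end joins it to [W] and to [G], whence [n.+2] steps. *)
Lemma ou_chain (tau h a : R) n : 0 < tau -> 0 <= h -> 0 < a ->
  exists (dS : measure_display) (S : measurableType dS) (Q : probability S R)
    (X0 X : S -> O) (M : S -> 'cV[R]_d),
  [/\ preserves Q P X0, preserves Q P X, measurable_fun setT M,
    (forall s i, `|M s i 0| <= 4 * (LW + LG)) /\
    (forall i, (\int[Q]_s (M s i 0 ^+ 2)%:E <=
      (h * (8 * (LW + LG) ^+ 2 * (1 + ou_db tau)))%:E)%E) &
    (LpNorm Q p r (fun s => G (X s) - W (X0 s) - M s)%R <=
     \sum_(k < n) h%:E * LpNorm P p r (cell_drift P W G (cube a) (tau + k%:R * h)) +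
     ((1 - expR (- tau)) * A + ou_b tau * B + h * (A + ou_db tau * B) + 4 * e +
      (expR (- (tau + n%:R * h)) * A + (1 - ou_b (tau + n%:R * h)) * B) +
      n.+2%:R * (d%:R * a))%:E)%E].
Proof.
move=> tau0 h0 a0.
pose tk k := tau + k%:R * h.
have tkS k : tk k.+1 = tk k + h by rewrite /tk -natr1; ring.
have tk_ge k : tau <= tk k by rewrite /tk lerDl mulr_ge0.
have tk0 k : 0 < tk k := lt_le_trans tau0 (tk_ge k).
have tkle k : tk k <= tk k.+1 by rewrite tkS lerDl.
pose al k := `|expR (- tk k.+1) - expR (- tk k)|.
pose be k := `|ou_b (tk k.+1) - ou_b (tk k)|.
have alE k : al k = expR (- tk k) - expR (- tk k.+1).
  by rewrite /al distrC ger0_norm// subr_ge0 ler_expR lerN2.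
have beE k : be k = ou_b (tk k.+1) - ou_b (tk k).
  by rewrite /be ger0_norm// subr_ge0 ou_b_monotone.
have sal : \sum_(k < n) al k = expR (- tk 0%N) - expR (- tk n).
  rewrite -(big_mkord xpredT al) (telescope_sumr_eq (fun k => - expR (- tk k)))//.
    by rewrite opprK addrC.
  by move=> k _; rewrite alE opprK addrC.
have sbe : \sum_(k < n) be k = ou_b (tk n) - ou_b (tk 0%N).
  rewrite -(big_mkord xpredT be) (telescope_sumr_eq (fun k => ou_b (tk k)))//.
have sal1 : \sum_(k < n) al k <= 1.
  have h1 := expR_gt0 (- tk n); have h2 : expR (- tk 0%N) <= 1 by rewrite -[leRHS]expR0 ler_expR oppr_le0 ltW.
  by rewrite sal; lra.
have sbe1 : \sum_(k < n) be k <= 1.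
  have h1 := ou_b_le1 (tk n); have h2 := ou_b_gt0 (tk0 0%N).
  by rewrite sbe; lra.
have al0 k : 0 <= al k by exact: normr_ge0.
have be0 k : 0 <= be k by exact: normr_ge0.
have alh k : al k <= h.
  have /andP[h1 _] := ou_a_tangent (tk k) h0.
  have h2 : expR (- tk k) <= 1 by rewrite -[leRHS]expR0 ler_expR oppr_le0 ltW.
  by rewrite -tkS in h1; rewrite alE; nra.
have beh k : be k <= h * ou_db tau.
  have h1 := ou_b_tangent (tk0 k.+1) (tk0 k); have h2 := ou_db_antitone tau0 (tk_ge k).
  have h3 : tk k.+1 - tk k = h by rewrite tkS addrC addKr.
  by rewrite h3 in h1; rewrite beE; nra.
have db0 := ou_db_ge0 tau.
set L := LW + LG; have L0 : 0 <= L by exact: addr_ge0.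
(* Grid time [tk j] has index [j.+1]; the two end steps carry no martingale part. *)
pose F k := match k with 0%N => W | j.+1 => if (j <= n)%N then ou_path W G (tk j) else G end.
pose D k := match k with 0%N => fun=> 0
  | j.+1 => if (j < n)%N then centered_incr P r W G (cube a) LW LG (tk j) h else fun=> 0 end.
pose c k := match k with 0%N => 0
  | j.+1 => if (j < n)%N then 2 * (L * (al j + be j)) else 0 end.
have mcube := measurable_cube a (d := d).
have mF k : measurable_fun setT (F k).
  by case: k => //= k; case: ifP => // _; exact: measurable_ou_path.
have mD k : measurable_fun setT (D k).
  case: k => [|k]/=; first exact: measurable_cst.
  by case: ifP => // _; exact: measurable_centered_incr.
have Dc k w i : `|D k w i 0| <= c k.
  case: k => [|k]/=; first by rewrite mxE normr0.
  case: ifP => // _; last by rewrite mxE normr0.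
  by rewrite /al /be tkS; exact: centered_incr_bound.
have D0 k m i : \int[P]_(w in (fun w => cube a (F k w)) @^-1` [set m]) (D k w i 0) = 0.
  have z (E : set O) : \int[P]_(w in E) (0 : 'cV[R]_d) i 0 = 0.
    by under eq_Rintegral do rewrite mxE; rewrite /Rintegral integral0.
  case: k => [|k]/=; first exact: z.
  case: (ltnP k n) => kn; last exact: z.
  by rewrite (ltnW kn); exact: centered_incr_mean.
have [dS [S [Q [X0 [X [M [pX0 pX mM [Mb M2] LM]]]]]]] := chain p1 r1 a0 mF mD Dc D0 n.+2.
have csum (f : R -> R) : f 0 = 0 -> \sum_(k < n.+2) f (c k) = \sum_(k < n) f (2 * (L * (al k + be k))).
  move=> f0; rewrite (big_ord_ends (f \o c))/= ltnn f0 addr0 add0r.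
  by apply: eq_bigr => k _; rewrite ltn_ord.
(* The two coefficients are monotone with values in [[0, 1]], so their increments add up to at most
   2. *)
have sumc : \sum_(k < n) 2 * (L * (al k + be k)) <= 4 * L.
  rewrite -mulr_sumr -mulr_sumr big_split/=; nra.
exists dS, S, Q, X0, X, M; split => //.
  split => [s i|i].
    by apply: (le_trans (Mb s i)); rewrite (csum id).
  apply: (le_trans (M2 i)); rewrite lee_fin (csum (fun x => x ^+ 2)) ?expr0n//.
  (* Sum of squares at most maximum times sum: the maximum is of order [h] and the sum is
     bounded. *)
  apply: (@le_trans _ _ (\sum_(k < n) 2 * (L * (h + h * ou_db tau)) * (2 * (L * (al k + be k))))).
    apply: ler_sum => k _; rewrite expr2 ler_wpM2r ?mulr_ge0 ?addr_ge0//.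
    by rewrite ler_wpM2l// ler_wpM2l// lerD.
  rewrite -mulr_sumr; apply: (@le_trans _ _ (2 * (L * (h + h * ou_db tau)) * (4 * L))).
    by rewrite ler_wpM2l// !mulr_ge0 ?addr_ge0 ?mulr_ge0.
  by rewrite le_eqVlt; apply/orP; left; apply/eqP; ring.
have FnE : F n.+2 = G by rewrite /= ltnn.
rewrite FnE in LM; apply: (le_trans LM).
rewrite (big_ord_ends (fun k => LpNorm P p r (fun w => F k.+1 w - F k w - D k w)%R)).
have -> : F 1%N = ou_path W G tau by rewrite /= /tk mul0r addr0.
rewrite FnE [F 0%N]/= [D 0%N]/= (_ : F n.+1 = ou_path W G (tk n)); last by rewrite /= leqnn.
rewrite (_ : D n.+1 = fun=> 0); last by rewrite /= ltnn.
have e1 : (LpNorm P p r (fun w => ou_path W G tau w - W w - 0)%R <=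
    ((1 - expR (- tau)) * A + ou_b tau * B)%:E)%E.
  rewrite (_ : (fun _ => _) = fun w => (expR (- tau) - 1) *: W w + ou_b tau *: G w); last first.
    by apply/funext => w; apply/matrixP => i j; rewrite !mxE; ring.
  apply: (le_trans (LpNorm_lin p1 r1 mW mG WA GB _ _)).
  rewrite distrC !ger0_norm//; first by rewrite sqrtr_ge0.
  by rewrite subr_ge0 -[leRHS]expR0 ler_expR oppr_le0 ltW.
have e2 : (LpNorm P p r (fun w => G w - ou_path W G (tk n) w - 0)%R <=
    (expR (- tk n) * A + (1 - ou_b (tk n)) * B)%:E)%E.
  rewrite (_ : (fun _ => _) = fun w => (- expR (- tk n)) *: W w + (1 - ou_b (tk n)) *: G w); last first.
    by apply/funext => w; apply/matrixP => i j; rewrite !mxE; ring.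
  apply: (le_trans (LpNorm_lin p1 r1 mW mG WA GB _ _)).
  by rewrite normrN !ger0_norm ?subr_ge0 ?ou_b_le1 ?expR_ge0.
have e3 : (\sum_(k < n) LpNorm P p r (fun w => F k.+2 w - F k.+1 w - D k.+1 w)%R <=
    \sum_(k < n) h%:E * LpNorm P p r (cell_drift P W G (cube a) (tk k)) +
    (h * (A + ou_db tau * B) + 4 * e)%:E)%E.
  apply: (@le_trans _ _ (\sum_(k < n) (h%:E * LpNorm P p r (cell_drift P W G (cube a) (tk k)) +
    (h * (expR (- tk k) - expR (- tk k.+1)) * A + h * (ou_db (tk k) - ou_db (tk k.+1)) * B +
      2 * ((al k + be k) * e))%:E)%E)).
    apply: lee_sum => k _; rewrite /= (ltn_ord k) (ltnW (ltn_ord k)) /al /be tkS.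
    exact: (ou_step p1 r1 mW mG WA GB mcube We Ge (tk0 k) h0).
  rewrite big_split/= leeD2l// sumEFin lee_fin.
  have sume : \sum_(k < n) 2 * ((al k + be k) * e) <= 4 * e.
    have -> : 4 * e = 2 * ((1 + 1) * e) by ring.
    by rewrite -mulr_sumr -mulr_suml big_split/= ler_wpM2l// ler_wpM2r// lerD.
  rewrite [leLHS]big_split/=; apply: lerD sume.
  rewrite -(big_mkord xpredT (fun k => h * (expR (- tk k) - expR (- tk k.+1)) * A +
    h * (ou_db (tk k) - ou_db (tk k.+1)) * B)).
  (* The second-order remainders telescope, leaving one factor [h] and the coefficients at time
     [tau]. *)
  rewrite (telescope_sumr_eq (fun k => - (h * A * expR (- tk k) + h * B * ou_db (tk k))))//; last first.
    by move=> k _; ring.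
  have q1 : 0 <= expR (- tk n) by exact: expR_ge0.
  have q2 := ou_db_ge0 (tk n).
  have q3 : expR (- tk 0%N) <= 1 by rewrite -[leRHS]expR0 ler_expR oppr_le0 ltW.
  have q4 : tk 0%N = tau by rewrite /tk mul0r addr0.
  rewrite q4 in q3 *.
  have hA : 0 <= h * A by exact: mulr_ge0.
  have hB : 0 <= h * B by exact: mulr_ge0.
  nra.
rewrite -/(tk n).
apply: (le_trans (leeD (leeD (leeD e1 e3) e2) (lexx _))).
set sm := (\sum_(k < n) _)%R.
rewrite [X in (X + _ + _)%E]addeCA -!addeA leeD2l// -!EFinD lee_fin.
by rewrite le_eqVlt; apply/orP; left; apply/eqP; ring.
Qed.

End ou_chain.

(** * Choice of the parameters of the chain *)

Section ou_coupling.
Context (R : realType) (d : nat) (dO : measure_display) (O : measurableType dO)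
  (P : probability O R) (p : R) (r : \bar R).
Hypotheses (p1 : 1 <= p) (r1 : (1 <= r)%E).
Variables (W G : O -> 'cV[R]_d).
Hypotheses (mW : measurable_fun setT W) (mG : measurable_fun setT G).
Hypotheses (Woo : (LpNorm P p r W < +oo)%E) (Goo : (LpNorm P p r G < +oo)%E).

Lemma ou_coupling (e : R) : 0 < e ->
  exists (dS : measure_display) (S : measurableType dS) (Q : probability S R) (X0 X : S -> O),
  [/\ preserves Q P X0, preserves Q P X &
    (LpNorm Q p r (fun s => W (X0 s) - G (X s))%R <=
     \int[lebesgue_measure]_(t in `]0%R, +oo[) LpNorm P p r (ou_score P W G t) + e%:E)%E].
Proof.
move=> e0; set I := (\int[_]_(t in _) _)%E.
have I0 : (0 <= I)%E by apply: integral_ge0 => t _; exact: LpNorm_ge0.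
(* If the integral is infinite, any coupling will do. *)
have [Ioo|Ioo] := leP +oo%E I.
  have -> : I = +oo%E by apply/eqP; rewrite eq_le leey.
  exists dO, O, P, id, id; split; rewrite ?addye// ?leey//.
have [A WA] : exists A, LpNorm P p r W = A%:E.
  by exists (fine (LpNorm P p r W)); rewrite fineK// ge0_fin_numE// LpNorm_ge0.
have [B GB] : exists B, LpNorm P p r G = B%:E.
  by exists (fine (LpNorm P p r G)); rewrite fineK// ge0_fin_numE// LpNorm_ge0.
have A0 : 0 <= A by rewrite -lee_fin -WA LpNorm_ge0.
have B0 : 0 <= B by rewrite -lee_fin -GB LpNorm_ge0.
(* Ten error terms: four from truncation, and one each from the initial step, the final step, the
   second-order remainders, the cube diameters, the grid average and the martingale part. *)
pose f := e / 10; have f0 : 0 < f by rewrite divr_gt0.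
have [LW LW0 We] := LpNorm_trunc p1 r1 mW Woo f0.
have [LG LG0 Ge] := LpNorm_trunc p1 r1 mG Goo f0.
have L0 : 0 <= 4 * (LW + LG) by rewrite mulr_ge0// addr_ge0.
have [v v0 small] := LpNorm_small d p1 r1 L0 f0.
have [y /andP[y0 y1] yf] := exists_small (mulr_ge0 (ler0n R 2) (addr_ge0 A0 B0)) f0.
(* The coefficient of [G] grows like a square root near 0: for [tau] at most [2 * t0] it is at most
   [2 * y]. *)
pose t0 := y ^+ 2; have t00 : 0 < t0 by rewrite exprn_gt0.
have db0 := ou_db_ge0 t0.
have K1 : 0 <= A + ou_db t0 * B by rewrite addr_ge0// mulr_ge0.
have K2 : 0 <= 8 * (LW + LG) ^+ 2 * (1 + ou_db t0) by rewrite !mulr_ge0 ?sqr_ge0// addr_ge0.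
have [h1 /andP[h10 _] h1f] := exists_small K1 f0.
have [h2 /andP[h20 _] h2v] := exists_small K2 v0.
(* [t0] keeps every shifted start below [2 * t0], [h1] controls the second-order remainders, [h2]
   brings the second moment below [v]. The constants are computed at [t0], and [ou_db_antitone]
   carries them to the later start [tau]. *)
pose h := Num.min t0 (Num.min h1 h2).
have h0 : 0 < h by rewrite !lt_min t00 h10 h20.
have ht0 : h <= t0 by rewrite ge_min lexx.
have hh1 : h <= h1 by rewrite !ge_min lexx orbT.
have hh2 : h <= h2 by rewrite !ge_min lexx !orbT.
(* Beyond time [T] both coefficients are within [1 / T] of their limits. *)
pose T := (A + B) / f + 1; have T0 : 0 < T by rewrite ltr_wpDl// divr_ge0 ?addr_ge0// ltW.
pose n := (Num.truncn (T / h)).+1.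
have nh : T <= n%:R * h by rewrite -ler_pdivrMr// ltW// truncnS_gt.
(* The cube side comes after [n], as [n.+2] multiplies it; the shift [u] comes after [a], as the
   function [m] depends on the cubes. *)
have [a /andP[a0 _] af] := exists_small (mulr_ge0 (ler0n R n.+2) (ler0n R d)) f0.
pose m t := LpNorm P p r (cell_drift P W G (cube a) t).
have mcube := measurable_cube a (d := d).
have mI : (\int[lebesgue_measure]_(t in `]0%R, +oo[) m t <= I)%E.
  apply: ge0_le_integral_nonmeasurable => t _; first exact: LpNorm_ge0.
  exact: (cell_drift_le_score p1 r1 mW mG WA GB).
have mm : measurable_fun setT m by exact: measurable_cell_drift_norm.
have m0 t : (0 <= m t)%E by exact: LpNorm_ge0.
have [u /andP[u0 uh] um] := averaged_sum_le n mm m0 t00 h0 f0 (le_lt_trans mI Ioo).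
pose tau := t0 + u; have t0tau : t0 <= tau by rewrite lerDl.
have tau0 : 0 < tau := lt_le_trans t00 t0tau.
have [dS [S [Q [X0 [X [M [pX0 pX mM [Mb M2] LM]]]]]]] :=
  ou_chain p1 r1 mW mG WA GB LW0 LG0 (ltW f0) We Ge n tau0 (ltW h0) a0.
exists dS, S, Q, X0, X; split => //.
have mX : measurable_fun setT (fun s => G (X s) - W (X0 s) - M s).
  apply: measurable_cVB => //; apply: measurable_cVB.
    exact: (measurableT_comp mG pX.1).
  exact: (measurableT_comp mW pX0.1).
rewrite -LpNormN//.
rewrite (_ : (fun s => _) = fun s => (G (X s) - W (X0 s) - M s) + M s); last first.
  by apply/funext => s; rewrite opprB subrK.
apply: (le_trans (LpNormD Q p1 r1 mX mM)).
have dbt : ou_db tau <= ou_db t0 by exact: ou_db_antitone.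
have Mf : (LpNorm Q p r M <= f%:E)%E.
  apply: small => // i; apply: (le_trans (M2 i)); rewrite lee_fin.
  apply: le_trans h2v; apply: ler_pM => //; first exact: ltW.
    by rewrite !mulr_ge0 ?sqr_ge0// addr_ge0// ou_db_ge0.
  apply: ler_wpM2l; first by rewrite mulr_ge0// sqr_ge0.
  by rewrite lerD2l.
apply: (le_trans (leeD LM Mf)).
have sumI : (\sum_(k < n) h%:E * LpNorm P p r (cell_drift P W G (cube a) (tau + k%:R * h)) <= I + f%:E)%E.
  apply: (@le_trans _ _ (\int[lebesgue_measure]_(t in `]0%R, +oo[) m t + f%:E)%E); last exact: leeD2r.
  apply: le_trans um; rewrite le_eqVlt; apply/orP; left; apply/eqP; apply: eq_bigr => k _.
  by rewrite /m; congr (_ * LpNorm _ _ _ (cell_drift _ _ _ _ _))%E; rewrite /tau; ring.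
have E1 : (1 - expR (- tau)) * A + ou_b tau * B <= f.
  have q1 : 1 - expR (- tau) <= tau by rewrite lerBlDr -lerBlDl expR_ge1Dx.
  have q2 : tau <= 2 * y ^+ 2 by rewrite mulr2n mulrDl mul1r lerD2l (le_trans uh).
  have q3 : ou_b tau <= 2 * y.
    apply: (le_trans (ou_b_small (ltW tau0))).
    rewrite -[leRHS](ger0_norm (mulr_ge0 (ler0n R 2) (ltW y0))) -sqrtr_sqr ler_wsqrtr//.
    by rewrite exprMn -natrX natrM -mulrA ler_wpM2l.
  have q4 : y ^+ 2 <= y by rewrite expr2 ger_pMl.
  apply: le_trans yf; rewrite mulrA mulrDr; apply: lerD; apply: ler_wpM2r => //.
    by rewrite (le_trans q1)// (le_trans q2)// mulrC ler_wpM2r.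
  by rewrite mulrC.
have E2 : h * (A + ou_db tau * B) <= f.
  apply: le_trans h1f; apply: ler_pM => //; first exact: ltW.
    by rewrite addr_ge0// mulr_ge0// ou_db_ge0.
  by rewrite lerD2l ler_wpM2r.
have E3 : expR (- (tau + n%:R * h)) * A + (1 - ou_b (tau + n%:R * h)) * B <= f.
  set t := tau + n%:R * h; have tT : T <= t by rewrite (le_trans nh)// lerDr ltW.
  have t_gt0 : 0 < t by exact: lt_le_trans tT.
  have q1 := ou_a_large t_gt0; have q2 := le_trans (ou_b_large t_gt0) q1.
  apply: (@le_trans _ _ (t^-1 * A + t^-1 * B)); first by rewrite lerD// ler_wpM2r.
  rewrite -mulrDr mulrC ler_pdivrMr//.
  have : (A + B) / f <= t by apply: le_trans tT; rewrite lerDl.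
  by rewrite ler_pdivrMr// mulrC.
have E4 : n.+2%:R * (d%:R * a) <= f by rewrite mulrA mulrC.
apply: (le_trans (leeD (leeD sumI (lexx _)) (lexx _))).
set x := (_ + n.+2%:R * _); have key : f + x + f <= e.
  have : e = 10 * f by rewrite /f mulrC divfK.
  by move: E1 E2 E3 E4; rewrite /x; move: (expR _) (ou_b _) => *; lra.
rewrite (_ : (I + f%:E + x%:E + f%:E)%E = (I + (f + x + f)%:E)%E); last by rewrite !EFinD !addeA.
by apply: leeD2l; rewrite lee_fin.
Qed.

End ou_coupling.

(** * Couplings of vanishing cost *)

Section orthants.
Context (R : realType) (d : nat).

Definition orthant (q : 'I_d -> R) := [set x : 'cV[R]_d | forall i, x i 0 < q i].

Let below (x : 'cV[R]_d) : exists n : nat, forall i, x i 0 < n%:R.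
Proof.
exists (Num.truncn (\sum_i `|x i 0|)).+1 => i; apply: le_lt_trans (truncnS_gt _).
by rewrite (bigD1 i)//= (le_trans (ler_norm _))// lerDl sumr_ge0.
Qed.

Lemma measurable_orthant q : measurable (orthant q).
Proof.
apply: (measurable_box (A := fun i => [set y | y < q i])) => i.
by rewrite -[X in measurable X](set_itvNyo (q i)).
Qed.

Lemma orthantI : setI_closed (range orthant).
Proof.
move=> _ _ [q _ <-] [s _ <-]; exists (fun i => Num.min (q i) (s i)) => //.
apply/seteqP; split => x /=.
  by move=> h; split => i; have := h i; rewrite lt_min => /andP[].
by move=> [h1 h2] i; rewrite lt_min h1 h2.
Qed.

(** A half-space that bounds one coordinate is the union of the orthants whose other bounds are
    [n]. *)
Lemma measurable_cVE : @measurable _ 'cV[R]_d = <<s range orthant >>.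
Proof.
apply/seteqP; split; last first.
  apply: smallest_sub; first exact: sigma_algebra_measurable.
  by move=> _ [q _ <-]; exact: measurable_orthant.
have mid : measurable_fun [set: g_sigma_algebraType (range orthant)]
    (fun x : g_sigma_algebraType (range orthant) => x : 'cV[R]_d).
  apply/measurable_cVP => i.
  apply: (measurability _ (RGenInftyO.measurableE R)).
  move=> _ [_ [x ->] <-]; rewrite setTI.
  rewrite (_ : _ @^-1` _ = \bigcup_n orthant (fun j => if j == i then x else n%:R)).
    by apply: bigcup_measurable => n _; apply: sub_sigma_algebra; exists (fun j => if j == i then x else n%:R).
  apply/seteqP; split => y /=; rewrite in_itv/=.
    move=> yx; have [n yn] := below y; exists n => // j.
    by case: eqP => // ->.
  by move=> [n _ /(_ i)]; rewrite eqxx.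
by move=> A mA; rewrite -[A]setTI; exact: mid.
Qed.

Lemma eq_measure_orthant (m1 m2 : probability 'cV[R]_d R) :
  (forall q, m1 (orthant q) = m2 (orthant q)) -> forall A, measurable A -> m1 A = m2 A.
Proof.
move=> m12; apply: (measure_unique (range orthant) (fun n => orthant (fun=> n%:R))) => //.
- exact: measurable_cVE.
- exact: orthantI.
- by rewrite -subTset => x _; have [n xn] := below x; exists n.
- by move=> A [q _ <-]; exact: m12.
- move=> n; rewrite (le_lt_trans (probability_le1 _ _)) ?ltry//; exact: measurable_orthant.
Qed.

Lemma std_gaussian_law_unique (g1 g2 : probability 'cV[R]_d R) :
  std_gaussian_law g1 -> std_gaussian_law g2 -> forall A, measurable A -> g1 A = g2 A.
Proof.
move=> h1 h2; apply: eq_measure_orthant => q.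
have -> : orthant q = [set x | forall i, [set y | y < q i] (x i 0)] by [].
have mq i : measurable [set y | y < q i] by rewrite -[X in measurable X](set_itvNyo (q i)).
by rewrite (h1 (fun i => [set y | y < q i]) mq) (h2 (fun i => [set y | y < q i]) mq).
Qed.

End orthants.

Section vanishing_cost.
Context (R : realType) (d : nat) (p : R) (r : \bar R).
Hypotheses (p1 : 1 <= p) (r1 : (1 <= r)%E).

Definition coupled (m1 m2 : probability 'cV[R]_d R) (c : \bar R) :=
  exists (dS : measure_display) (S : measurableType dS) (Q : probability S R) (X Y : S -> 'cV[R]_d),
  [/\ preserves Q m1 X, preserves Q m2 Y & (LpNorm Q p r (fun s => X s - Y s)%R <= c)%E].

Lemma coupledC m1 m2 c : coupled m1 m2 c -> coupled m2 m1 c.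
Proof.
move=> [dS [S [Q [X [Y [pX pY XY]]]]]]; exists dS, S, Q, Y, X; split => //.
by rewrite -LpNormN//; under eq_fun do rewrite opprB.
Qed.

(** When [X] and [Y] are closer than [h], [X] in the orthant moved inwards forces [Y] into the
    original one; Markov's inequality bounds the exceptional event. *)
Let orthant_shift (m1 m2 : probability 'cV[R]_d R) (q : 'I_d -> R) (h : R) :
  (forall e : R, 0 < e -> coupled m1 m2 e%:E) -> 0 < h ->
  (m1 (orthant (fun i => (q i - h)%R)) <= m2 (orthant q))%E.
Proof.
move=> c12 h0; apply/lee_addgt0Pr => e e0.
have p0 : 0 < p by apply: lt_le_trans p1.
have hp0 : 0 < h `^ p by exact: powR_gt0.
(* With this cost Markov's inequality gives exactly the probability bound [e]. *)
pose c := h * e `^ p^-1; have c0 : 0 < c by rewrite mulr_gt0// powR_gt0.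
have [dS [S [Q [X [Y [pX pY XY]]]]]] := c12 _ c0.
have mX := pX.1; have mY := pY.1.
pose E := [set s | h <= lrnorm r (X s - Y s)].
have mD : measurable_fun setT (fun s => X s - Y s) by exact: measurable_cVB.
have mE : measurable E.
  rewrite (_ : E = (fun s => lrnorm r (X s - Y s)) @^-1` `[h, +oo[); last first.
    by apply/seteqP; split => s /=; rewrite in_itv/= andbT.
  rewrite -[X in measurable X]setTI.
  exact: (measurableT_comp (@measurable_lrnorm _ _ _) mD).
have QE : (Q E <= e%:E)%E.
  have : ((h `^ p)%:E * Q E <= (c `^ p)%:E)%E.
    rewrite -integral_cst//; apply: (@le_trans _ _ (LpNorm Q p r (fun s => X s - Y s)%R `^ p)%E); last first.
      by rewrite -poweR_EFin; apply: le_poweR => //; [exact: ltW|exact: LpNorm_ge0].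
    rewrite LpNorm_powR//; apply: (@le_trans _ _ (\int[Q]_(s in E) (lrnorm r (X s - Y s) `^ p)%:E)%E).
      apply: ge0_le_integral_nonmeasurable => s Es; first by rewrite lee_fin ltW.
      by rewrite lee_fin ge0_ler_powR ?nnegrE ?lrnorm_ge0// ltW.
    apply: ge0_subset_integral => //; first exact: measurable_lrnorm_powR.
    by move=> s _; rewrite lee_fin powR_ge0.
  rewrite /c powRM ?powR_ge0 ?(ltW h0)// -powRrM mulVf ?gt_eqF// powRr1 ?(ltW e0)// EFinM.
  by rewrite lee_pmul2l// lte_fin.
have mo s := @measurable_orthant R d s.
rewrite -(pX.2 _ (mo _)) -(pY.2 _ (mo _)).
have mYo : measurable (Y @^-1` orthant q) by rewrite -[X in measurable X]setTI; exact: mY.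
have mXo : measurable (X @^-1` orthant (fun i => q i - h)) by rewrite -[X in measurable X]setTI; exact: mX.
apply: (@le_trans _ _ (Q (Y @^-1` orthant q `|` E))).
  apply: le_measure; rewrite ?inE//; first exact: measurableU.
  move=> s /= Xs; have [Es|Es] := leP h (lrnorm r (X s - Y s)); [by right|left => i].
  have := le_coord_lrnorm r1 (X s - Y s) i; have := Xs i; rewrite !mxE => h1.
  by move=> /le_lt_trans/(_ Es); rewrite ltr_norml => /andP[]; lra.
by apply: (le_trans (measureU2 _ _ _)) => //; exact: leeD2l.
Qed.

(** An open orthant is the increasing union of its inward shifts, so continuity from below removes
    the shift. *)
Let orthant_le (m1 m2 : probability 'cV[R]_d R) (q : 'I_d -> R) :
  (forall e : R, 0 < e -> coupled m1 m2 e%:E) -> (m1 (orthant q) <= m2 (orthant q))%E.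
Proof.
move=> c12; pose F n := orthant (fun i => q i - n.+1%:R^-1).
have FE : orthant q = \bigcup_n F n.
  apply/seteqP; split => x /=.
    move=> xq.
    have [n xn] : exists n : nat, forall i, (q i - x i 0)^-1 < n.+1%:R.
      exists (Num.truncn (\sum_i (q i - x i 0)^-1)) => i; apply: le_lt_trans (truncnS_gt _).
      by rewrite (bigD1 i)//= lerDl sumr_ge0// => j _; rewrite invr_ge0 subr_ge0 ltW.
    exists n => // i; rewrite ltrBrDr -ltrBrDl.
    by rewrite invf_plt ?posrE ?subr_gt0// xn.
  by move=> [n _ xn] i; apply: (lt_le_trans (xn i)); rewrite gerBl invr_ge0.
have cvF : m1 (F n) @[n --> \oo] --> m1 (orthant q).
  rewrite FE; apply: nondecreasing_cvg_mu.
  - by move=> n; exact: measurable_orthant.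
  - by apply: bigcup_measurable => n _; exact: measurable_orthant.
  - move=> n n' nn'; apply/subsetPset => x /= h i; apply: (lt_le_trans (h i)).
    by rewrite lerD2l lerN2 lef_pV2 ?posrE// ler_nat.
rewrite -(cvg_lim _ cvF)//; apply: lime_le; first by apply/cvg_ex; eexists; exact: cvF.
by apply: nearW => n; apply: orthant_shift.
Qed.

Lemma coupled_eq (m1 m2 : probability 'cV[R]_d R) :
  (forall e : R, 0 < e -> coupled m1 m2 e%:E) -> forall A, measurable A -> m1 A = m2 A.
Proof.
move=> c12; apply: eq_measure_orthant => q; apply/eqP; rewrite eq_le !orthant_le// => e e0.
by apply: coupledC; exact: c12.
Qed.

End vanishing_cost.

Lemma measurable_fun_RV (R : realType) (dO dT : measure_display) (O : measurableType dO)
  (T : measurableType dT) (P : probability O R) (f : O -> T) :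
  measurable_fun setT f -> exists X : {RV P >-> T}, X = f :> (O -> T).
Proof.
move=> mf; pose f' : {mfun O >-> T} := HB.pack f (isMeasurableFun.Build _ _ _ _ f mf).
by exists f'.
Qed.

(** Covers the case in which the infimum of the costs is infinite. *)
Lemma exists_product_coupling (R : realType) (d1 d2 : measure_display) (T1 : measurableType d1)
  (T2 : measurableType d2) (m1 : probability T1 R) (m2 : probability T2 R) :
  exists (dS : measure_display) (S : measurableType dS) (Q : probability S R) (X : S -> T1) (Y : S -> T2),
  preserves Q m1 X /\ preserves Q m2 Y.
Proof.
exists _, (T1 * T2)%type, (m1 \x m2)%E, fst, snd; split; split => // A mA.
  rewrite (_ : fst @^-1` A = A `*` setT); last by apply/seteqP; split => x //= [].
  by rewrite -[LHS]/((m1 \x m2)%E (A `*` setT)) product_measure1E// [X in (_ * X)%E](@probability_setT _ _ _ m2) mule1.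
rewrite (_ : snd @^-1` A = setT `*` A); last by apply/seteqP; split => x //= [].
by rewrite -[LHS]/((m1 \x m2)%E (setT `*` A)) product_measure1E// [X in (X * _)%E](@probability_setT _ _ _ m1) mul1e.
Qed.

Theorem lemma5p1 (R : realType) (d : nat) (p : R) (r : \bar R)
    (mu : probability 'cV[R]_d R) (Sigma : 'M[R]_d)
    (hp : 1 <= p) (hr : (1 <= r)%E) (hmu : finite_moment p mu)
    (hsym : symmetric_mx Sigma) (hpos : posdef_mx Sigma) :
  exists (dO : measure_display) (Omega : measurableType dO)
         (P : probability Omega R) (W Z : {RV P >-> 'cV[R]_d}),
    [/\ has_law P W mu, is_std_gaussian P Z &
      forall (dO' : measure_display) (Omega' : measurableType dO')
             (P' : probability Omega' R) (W' Z2 : {RV P' >-> 'cV[R]_d}),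
        has_law P' W' mu -> is_std_gaussian P' Z2 -> independent_RV P' W' Z2 ->
        (LpNorm P p r (fun w => (W w - sqrtmx Sigma *m Z w)%R)
         <= 2%:E * \int[lebesgue_measure]_(t in `]0%R, +oo[)
                      LpNorm P' p r (rho P' Sigma W' Z2 t))%E].
Proof.
have [g gauss_g] := exists_std_gaussian R d; set T := sqrtmx Sigma.
(* The infimum of these costs involves only [mu] and [Sigma], so a single coupling serves all later
   choices of [W'] and [Z2]. *)
pose cost := [set c : \bar R | exists (dS : measure_display) (S : measurableType dS)
    (Q : probability S R) (X Y : S -> 'cV[R]_d),
  [/\ preserves Q mu X, preserves Q g Y & c = LpNorm Q p r (fun s => X s - T *m Y s)%R]].
pose Wp := ereal_inf cost.
have Wp0 : (0 <= Wp)%E.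
  by apply: le_ereal_inf_tmp => _ [dS [S [Q [X [Y [_ _ ->]]]]]]; exact: LpNorm_ge0.
have Wp_le (dO' : measure_display) (Omega' : measurableType dO') (P' : probability Omega' R)
    (W' Z2 : {RV P' >-> 'cV[R]_d}) : has_law P' W' mu -> is_std_gaussian P' Z2 ->
    (Wp <= \int[lebesgue_measure]_(t in `]0%R, +oo[) LpNorm P' p r (rho P' Sigma W' Z2 t))%E.
  move=> hW hZ; apply/lee_addgt0Pr => e e0.
  have mW : measurable_fun setT W' by exact: measurable_funP.
  have mZ : measurable_fun setT Z2 by exact: measurable_funP.
  have pW : preserves P' mu W' by split.
  have pZ : preserves P' g Z2.
    by split => //; exact: (std_gaussian_law_unique (g1 := distribution P' Z2)).
  have mG : measurable_fun setT (fun w => T *m Z2 w) by exact: measurable_mulmx.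
  have Goo : (LpNorm P' p r (fun w => T *m Z2 w) < +oo)%E.
    by apply: LpNorm_mulmx_lty => //; exact: std_gaussian_LpNorm_lty.
  have [dS [S [Q [X0 [X [pX0 pX XI]]]]]] :=
    ou_coupling hp hr mW mG (has_law_LpNorm_lty hp hr hmu hW) Goo e0.
  apply: le_trans XI; apply: ereal_inf_lbound.
  exists dS, S, Q, (fun s => W' (X0 s)), (fun s => Z2 (X s)); split => //.
    exact: preserves_comp pX0 pW.
  exact: preserves_comp pX pZ.
(* Here the factor 2 leaves no slack, so the bound must be met exactly: on R^d with the Gaussian
   law, [Z] is the identity and [W] is its image under [T]. *)
have [W0|Wneq0] := eqVneq Wp 0%E.
  have mf : measurable_fun setT (fun x : 'cV[R]_d => T *m x) by apply: measurable_mulmx; exact: measurable_id.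
  have [W WE] := measurable_fun_RV g mf.
  have [Z ZE] := measurable_fun_RV g (@measurable_id _ 'cV[R]_d setT).
  exists _, 'cV[R]_d, g, W, Z; split.
  - move=> A mA; apply/esym; apply: (coupled_eq hp hr (m2 := distribution g W)) mA => e e0.
    have : (Wp < e%:E)%E by rewrite W0 lte_fin.
    move=> /ereal_inf_lt[_ [dS [S [Q [X [Y [pX pY ->]]]]]] ce].
    exists dS, S, Q, X, (fun s => T *m Y s); split => //; last exact: ltW.
    apply: (preserves_comp pY (g := fun x => T *m x)); split => // B mB.
    by rewrite /= -WE.
  - by move=> A mA; rewrite -(gauss_g A mA) -[LHS]/(g (Z @^-1` _)) ZE.
  - move=> dO' Omega' P' W' Z2 _ _ _; rewrite WE ZE; under eq_fun do rewrite subrr.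
    by rewrite LpNorm_cst0// mule_ge0// integral_ge0// => t _; exact: LpNorm_ge0.
have [dS [S [Q [X [Y [pX pY XY]]]]]] : exists (dS : measure_display) (S : measurableType dS)
    (Q : probability S R) (X Y : S -> 'cV[R]_d),
  [/\ preserves Q mu X, preserves Q g Y & (LpNorm Q p r (fun s => X s - T *m Y s)%R <= 2%:E * Wp)%E].
  have Wgt0 : (0 < Wp)%E by rewrite lt0e Wneq0.
  have [Wpoo|] := ltP Wp +oo%E.
    (* Strict because the infimum is positive and finite, so some coupling has cost below
       [2 * Wp]. *)
    have : (Wp < 2%:E * Wp)%E.
      have Wf : Wp \is a fin_num by rewrite ge0_fin_numE.
      rewrite -(fineK Wf) -EFinM lte_fin.
      by have : 0 < fine Wp; [rewrite -lte_fin fineK|lra].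
    move=> /ereal_inf_lt[_ [dS [S [Q [X [Y [pX pY ->]]]]]] c2].
    by exists dS, S, Q, X, Y; split => //; exact: ltW.
  rewrite leye_eq => /eqP ->; rewrite gt0_muley ?leey//.
  have [dS [S [Q [X [Y [pX pY]]]]]] := exists_product_coupling mu g.
  by exists dS, S, Q, X, Y; split => //; rewrite leey.
have [W WE] := measurable_fun_RV Q pX.1.
have [Z ZE] := measurable_fun_RV Q pY.1.
exists dS, S, Q, W, Z; split.
- by move=> A mA; rewrite -(pX.2 A mA) -[LHS]/(Q (W @^-1` _)) WE.
- move=> A mA; rewrite -(gauss_g A mA) -[LHS]/(Q (Z @^-1` _)) ZE pY.2//.
  exact: measurable_box.
- move=> dO' Omega' P' W' Z2 hW hZ _; rewrite WE ZE.
  by apply: (le_trans XY); rewrite lee_wpmul2l// Wp_le.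
Qed.
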